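(* Let $\Omega=(0,1)$ and $T>0$, and let $B_{\mathrm{ext}}=\partial_x\psi_{\mathrm{ext}}$, where $\psi_{\mathrm{ext}}\in C^2(\Omega)$ satisfies $|\psi_{\mathrm{ext}}(x)|\ge \frac{c_0}{\mathrm{dist}(x,\partial\Omega)^{\gamma}}-\frac1{c_0}$ for all $x\in\Omega$, with constants $\gamma>0$, $c_0>0$. Assume that $E=(E_1,E_2)$ and $B$ belong to $C^1([0,T]\times\Omega)$, satisfy $\partial_tB=-\partial_xE_2$, and that there exist constants $C_0,C_0'>0$ with $|E(s,y)|\le C_0$ and $|B(s,y)|\le C_0'$ for all $(s,y)\in[0,T]\times\Omega$. Then for any $(t,x,v)\in(0,T]\times\Omega\times\mathbb{R}^2$ the characteristic system $$\frac{dX}{ds}=\hat V_1(s),\quad\frac{dV_1}{ds}=E_1(s,X)+\hat V_2(s)\,\check B(s,X),\quad\frac{dV_2}{ds}=E_2(s,X)-\hat V_1(s)\,\check B(s,X),\quad X(t)=x,\ V(t)=v,$$ admits a unique $C^1$ solution $(X(s),V(s))$ in $[0,T]$, with $X(s)\in\Omega$ for every $s\in[0,T]$.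
   Context: Notation: $\check B(s,y)=B(s,y)+B_{\mathrm{ext}}(y)$; $\hat V=(\hat V_1,\hat V_2)=V/\sqrt{1+|V|^2}$. *)

(* Defs.v *)
From Stdlib Require Import Reals Lra Psatz.
From Coquelicot Require Import Coquelicot.
Open Scope R_scope.

Definition Omega (x : R) : Prop := 0 < x < 1.

Definition closed_interval (a b s : R) : Prop := a <= s <= b.

Definition boundary (D : R -> Prop) (x : R) : Prop :=
  forall P : R -> Prop, locally x P ->
    (exists y, P y /\ D y) /\ (exists y, P y /\ ~ D y).

Definition dist_set (x : R) (A : R -> Prop) : R :=
  real (Glb_Rbar (fun d => exists y, A y /\ d = Rabs (x - y))).

(* Derivative relative to [D]: one-sided at an endpoint of a closed interval,
   equal to [is_derive] at an interior point. *)
Definition is_derive_in (D : R -> Prop) (f : R -> R) (x l : R) : Prop :=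
  filterdiff f (within D (locally x)) (fun h => scal h l).

Definition C1_on (D : R -> Prop) (f : R -> R) : Prop :=
  exists f' : R -> R,
    (forall x, D x -> is_derive_in D f x (f' x)) /\
    continuous_on D f /\ continuous_on D f'.

(* For an open set [D]. *)
Definition Cn_open (n : nat) (D : R -> Prop) (f : R -> R) : Prop :=
  forall (k : nat) (x : R), (k <= n)%nat -> D x ->
    ex_derive_n f k x /\ continuous (Derive_n f k) x.

Definition strip (T : R) (p : R * R) : Prop :=
  closed_interval 0 T (fst p) /\ Omega (snd p).

(* C^1([0,T] x Omega), with one-sided time derivatives at s = 0 and s = T. *)
Definition C1_strip (T : R) (f : R -> R -> R) : Prop :=
  exists fs fy : R -> R -> R,
    (forall s y, closed_interval 0 T s -> Omega y ->
       is_derive_in (closed_interval 0 T) (fun s' => f s' y) s (fs s y) /\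
       is_derive (fun y' => f s y') y (fy s y)) /\
    continuous_on (strip T) (fun p => f (fst p) (snd p)) /\
    continuous_on (strip T) (fun p => fs (fst p) (snd p)) /\
    continuous_on (strip T) (fun p => fy (fst p) (snd p)).

(* Coquelicot's [norm] on [R * R] is the Euclidean norm. *)
Definition norm2 (w : R * R) : R := norm w.

Definition hat1 (w : R * R) : R := fst w / sqrt (1 + norm2 w ^ 2).
Definition hat2 (w : R * R) : R := snd w / sqrt (1 + norm2 w ^ 2).

(* The fields are only meaningful for positions in [Omega], so staying in
   [Omega] is part of being a solution. *)
Definition is_characteristic (T : R) (E1 E2 B : R -> R -> R) (Bext : R -> R)
    (t x : R) (v : R * R) (X V1 V2 : R -> R) : Prop :=
  let I := closed_interval 0 T in
  let Bcheck s y := B s y + Bext y in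
  (C1_on I X /\ C1_on I V1 /\ C1_on I V2) /\
  (forall s, I s -> Omega (X s)) /\
  (forall s, I s ->
     is_derive_in I X s (hat1 (V1 s, V2 s)) /\
     is_derive_in I V1 s
       (E1 s (X s) + hat2 (V1 s, V2 s) * Bcheck s (X s)) /\
     is_derive_in I V2 s
       (E2 s (X s) - hat1 (V1 s, V2 s) * Bcheck s (X s))) /\
  X t = x /\ (V1 t, V2 t) = v.

Lemma norm2_eq (a b : R) : norm2 (a, b) = sqrt (a ^ 2 + b ^ 2).
Proof.
change (sqrt (Rabs a ^ 2 + Rabs b ^ 2) = sqrt (a ^ 2 + b ^ 2)).
now rewrite !pow2_abs.
Qed.

Lemma boundary_Omega (x : R) : boundary Omega x <-> x = 0 \/ x = 1.
Proof.
split.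
- intros H.
  destruct (Req_dec x 0) as [|n0]; [now left|].
  destruct (Req_dec x 1) as [|n1]; [now right|].
  exfalso.
  destruct (Rlt_dec x 0) as [l|l].
  { destruct (H (fun y => y < 0)) as [[y [h1 h2]] _].
    - apply open_lt; exact l.
    - unfold Omega in h2; lra. }
  destruct (Rlt_dec 1 x) as [g|g].
  { destruct (H (fun y => 1 < y)) as [[y [h1 h2]] _].
    - apply open_gt; exact g.
    - unfold Omega in h2; lra. }
  destruct (H (fun y => 0 < y /\ y < 1)) as [_ [y [h1 h2]]].
  + apply filter_and; [apply open_gt | apply open_lt]; lra.
  + apply h2; exact h1.
- intros H P [eps He].
  assert (e0 := cond_pos eps).
  set (d := Rmin (eps / 2) (1 / 2)).
  assert (d1 : 0 < d) by (apply Rmin_pos; lra).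
  assert (d2 : d <= eps / 2) by apply Rmin_l.
  assert (d3 : d <= 1 / 2) by apply Rmin_r.
  assert (HP : P x) by (apply He, ball_center).
  destruct H as [-> | ->]; split.
  + exists d; split; [|unfold Omega; lra].
    apply He; change (Rabs (d - 0) < eps); rewrite Rabs_pos_eq; lra.
  + exists 0; split; [exact HP|unfold Omega; lra].
  + exists (1 - d); split; [|unfold Omega; lra].
    apply He; change (Rabs (1 - d - 1) < eps); rewrite Rabs_left; lra.
  + exists 1; split; [exact HP|unfold Omega; lra].
Qed.

Lemma dist_boundary_Omega (x : R) :
  Omega x -> dist_set x (boundary Omega) = Rmin x (1 - x).
Proof.
intros [h0 h1]; unfold dist_set.
rewrite (is_glb_Rbar_unique _ (Finite (Rmin x (1 - x)))); [reflexivity|].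
split.
- intros d [y [hy ->]]; simpl.
  apply boundary_Omega in hy; destruct hy as [-> | ->].
  + rewrite Rabs_pos_eq by lra; rewrite Rminus_0_r; apply Rmin_l.
  + rewrite Rabs_left by lra; assert (h := Rmin_r x (1 - x)); lra.
- intros b hb; unfold Rmin; destruct (Rle_dec x (1 - x)); apply hb.
  + exists 0; split; [apply boundary_Omega; now left|].
    rewrite Rabs_pos_eq; lra.
  + exists 1; split; [apply boundary_Omega; now right|].
    rewrite Rabs_left; lra.
Qed.

(* Main.v *)
Require Import Defs.
From Stdlib Require Import Reals Lra Psatz.
From Coquelicot Require Import Coquelicot.
Open Scope R_scope.

(** The only obstruction to solving the characteristic system on all of [0, T] is that [Bext]
    is singular at the walls, so the heart of the matter is an a priori bound that keeps every
    solution at a fixed distance from them.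

    Two quantities are controlled along a characteristic.  The magnetic force does no work, so
    the energy [sqrt (1 + |V|^2)] grows at most linearly ([lorentz_growth]).  Next, let
    [A s y] be the integral of [B s] from [1/2] to [y].  By Faraday's law
    ([is_derive_vector_potential]) the canonical momentum [V2 + A(s, X) + psi_ext(X)] has
    derivative [E2 s (1/2)], which is bounded.  As [V2] and [A] are bounded, so is [psi_ext(X)]
    ([external_potential_bound]); since [psi_ext] blows up at the walls, [X] remains in a
    compact interval [rho, 1 - rho] depending only on the data ([potential_barrier]).

    With [d = rho / 2], the fields are then frozen outside [0, T] x [d, 1 - d].  The resulting
    system is globally bounded and Lipschitz, hence uniquely and globally solvable
    ([picard_existence], [bounded_lipschitz_uniqueness]).  As long as its solution stays in
    [d, 1 - d] it solves the original system, so it satisfies the a priori bound and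
    stays in the smaller interval [rho, 1 - rho]; a continuity argument ([interval_bootstrap])
    shows that it never leaves.  Conversely any solution of the original system satisfies the
    bound, so it solves the frozen system and coincides with the one constructed. *)

(** * Clamping and mean value inequalities *)

Definition clamp (a b x : R) : R := Rmax a (Rmin x b).

Lemma clamp_in (a b x : R) : a <= b -> closed_interval a b (clamp a b x).
Proof.
intros h; unfold closed_interval, clamp, Rmax, Rmin.
destruct (Rle_dec x b), (Rle_dec _ _); lra.
Qed.

Lemma clamp_id (a b x : R) : closed_interval a b x -> clamp a b x = x.
Proof.
unfold closed_interval, clamp; intros h.
now rewrite Rmin_left, Rmax_right by lra.
Qed.

Lemma clamp_lipschitz (a b x y : R) :
  Rabs (clamp a b x - clamp a b y) <= Rabs (x - y).
Proof.
unfold clamp, Rmax, Rmin.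
repeat destruct (Rle_dec _ _); unfold Rabs; repeat destruct (Rcase_abs _); lra.
Qed.

Lemma lipschitz_continuous (f : R -> R) (K x : R) :
  (forall y, Rabs (f y - f x) <= K * Rabs (y - x)) -> continuous f x.
Proof.
intros h; apply filterlim_locally; intros eps.
assert (hK : 0 < Rabs K + 1) by (assert (h1 := Rabs_pos K); lra).
assert (hd : 0 < eps / (Rabs K + 1)) by (apply Rdiv_lt_0_compat; [apply cond_pos|lra]).
exists (mkposreal _ hd); intros y hy.
change (Rabs (y - x) < eps / (Rabs K + 1)) in hy.
change (Rabs (f y - f x) < eps).
apply Rle_lt_trans with ((Rabs K + 1) * Rabs (y - x)).
- apply Rle_trans with (1 := h y), Rmult_le_compat_r; [apply Rabs_pos|].
  assert (h1 := Rle_abs K); lra.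
- apply (Rmult_lt_compat_l (Rabs K + 1)) in hy; [|lra].
  replace ((Rabs K + 1) * (eps / (Rabs K + 1))) with (pos eps) in hy by (field; lra).
  exact hy.
Qed.

Lemma clamp_continuous (a b x : R) : continuous (clamp a b) x.
Proof.
apply lipschitz_continuous with 1; intros y; rewrite Rmult_1_l; apply clamp_lipschitz.
Qed.

(** The comparison slope [Rmax 0 (h' r)] agrees with [h'] inside the interval and is
    nonnegative everywhere, so it does not matter that the intermediate point given by
    [MVT_gen] may be an endpoint, where [h] need not be differentiable. *)
Lemma derive_nonneg_increment (h h' : R -> R) (a b : R) :
  a <= b ->
  (forall r, a < r < b -> is_derive h r (h' r)) ->
  (forall r, a <= r <= b -> continuous h r) ->
  (forall r, a < r < b -> 0 <= h' r) ->
  h a <= h b.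
Proof.
intros hab hd hc hp.
destruct (MVT_gen h a b (fun r => Rmax 0 (h' r))) as [c [_ e]].
- rewrite Rmin_left, Rmax_right by lra; intros r hr.
  rewrite Rmax_right by now apply hp.
  now apply hd.
- rewrite Rmin_left, Rmax_right by lra; intros r hr.
  now apply continuity_pt_filterlim, hc.
- assert (h1 := Rmax_l 0 (h' c)).
  assert (0 <= Rmax 0 (h' c) * (b - a)) by (apply Rmult_le_pos; lra).
  lra.
Qed.

Lemma derive_le_increment (f f' g g' : R -> R) (a b : R) :
  a <= b ->
  (forall r, a < r < b -> is_derive f r (f' r)) ->
  (forall r, a <= r <= b -> continuous f r) ->
  (forall r, a < r < b -> is_derive g r (g' r)) ->
  (forall r, a <= r <= b -> continuous g r) ->
  (forall r, a < r < b -> Rabs (f' r) <= g' r) ->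
  Rabs (f b - f a) <= g b - g a.
Proof.
intros hab df cf dg cg hle.
assert (h1 : g a - f a <= g b - f b).
{ apply (derive_nonneg_increment (fun r => g r - f r) (fun r => g' r - f' r)); try easy.
  - intros r hr; apply (is_derive_minus g f); [now apply dg|now apply df].
  - intros r hr; apply (continuous_minus g f); [now apply cg|now apply cf].
  - intros r hr; assert (h := hle r hr).
    assert (h2 := Rle_abs (f' r)); lra. }
assert (h2 : g a + f a <= g b + f b).
{ apply (derive_nonneg_increment (fun r => g r + f r) (fun r => g' r + f' r)); try easy.
  - intros r hr; apply (is_derive_plus g f); [now apply dg|now apply df].
  - intros r hr; apply (continuous_plus g f); [now apply cg|now apply cf].
  - intros r hr; assert (h := hle r hr).
    assert (h2 := Rabs_maj2 (f' r)); lra. }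
apply Rabs_le; lra.
Qed.

(** * Bounded Lipschitz systems of differential equations *)

(** Twice the hyperbolic cosine of [2 L (s - t)].  Being even around [t], it replaces the usual
    factor [exp (2 L |s - t|)] by a smooth function that serves both time directions at once. *)
Definition cosh_weight (L t s : R) : R := exp (2 * L * (s - t)) + exp (- (2 * L * (s - t))).
Definition sinh_weight (L t s : R) : R := exp (2 * L * (s - t)) - exp (- (2 * L * (s - t))).

Lemma cosh_weight_ge_1 (L t s : R) : 1 <= cosh_weight L t s.
Proof.
unfold cosh_weight; set (y := 2 * L * (s - t)).
assert (h1 := exp_pos y); assert (h2 := exp_pos (- y)).
destruct (Rle_dec 0 y).
- assert (h := exp_ineq1_le y); lra.
- assert (h := exp_ineq1_le (- y)); lra.
Qed.

Lemma is_derive_sinh_weight (L t s : R) :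
  is_derive (sinh_weight L t) s (2 * L * cosh_weight L t s).
Proof. unfold sinh_weight, cosh_weight; auto_derive; [easy|]; unfold Rminus; ring. Qed.

(** One integration from [t] gains a factor [1 / (2 L)] on the weight, because the weight is
    [1 / (2 L)] times the derivative of [sinh_weight], whose modulus is at most the weight.
    Together with the Lipschitz constant [L] this makes one Picard step a contraction by [1/2]
    on the whole line, and it is also what drives the uniqueness argument. *)
Lemma cosh_weight_absorbs (L t s : R) (c : R) (f f' : R -> R) :
  0 < L -> 0 <= c -> f t = 0 ->
  (forall r, Rmin t s < r < Rmax t s -> is_derive f r (f' r)) ->
  (forall r, Rmin t s <= r <= Rmax t s -> continuous f r) ->
  (forall r, Rmin t s < r < Rmax t s -> Rabs (f' r) <= c * cosh_weight L t r) ->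
  Rabs (f s) <= c / (2 * L) * cosh_weight L t s.
Proof.
intros hL hc f0 df cf hle.
set (g := fun r => c / (2 * L) * sinh_weight L t r).
assert (dg : forall r, is_derive g r (c * cosh_weight L t r)).
{ intros r; unfold g.
  replace (c * cosh_weight L t r) with (scal (c / (2 * L)) (2 * L * cosh_weight L t r))
    by (change (c / (2 * L) * (2 * L * cosh_weight L t r) = c * cosh_weight L t r); field; lra).
  apply (is_derive_scal (sinh_weight L t)), is_derive_sinh_weight. }
assert (cg : forall r, continuous g r).
{ intros r; apply (ex_derive_continuous g); eexists; apply dg. }
assert (g0 : g t = 0).
{ unfold g, sinh_weight; replace (2 * L * (t - t)) with 0 by ring.
  rewrite Ropp_0; ring. }
assert (hk : 0 <= c / (2 * L)) by (apply Rdiv_le_0_compat; lra).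
assert (e1 := exp_pos (2 * L * (s - t))).
assert (e2 := exp_pos (- (2 * L * (s - t)))).
destruct (Rle_dec t s) as [hts|hts].
- rewrite Rmin_left in df, cf, hle by lra; rewrite Rmax_right in df, cf, hle by lra.
  assert (h : Rabs (f s - f t) <= g s - g t).
  { apply (derive_le_increment f f' g (fun r => c * cosh_weight L t r)); auto. }
  rewrite f0, g0, !Rminus_0_r in h.
  apply Rle_trans with (1 := h); unfold g; apply Rmult_le_compat_l; [easy|].
  unfold sinh_weight, cosh_weight; lra.
- rewrite Rmin_right in df, cf, hle by lra; rewrite Rmax_left in df, cf, hle by lra.
  assert (h : Rabs (f t - f s) <= g t - g s).
  { apply (derive_le_increment f f' g (fun r => c * cosh_weight L t r)); auto; lra. }
  rewrite f0, g0, Rminus_0_l, Rabs_Ropp in h.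
  apply Rle_trans with (1 := h).
  replace (0 - g s) with (c / (2 * L) * - sinh_weight L t s) by (unfold g; ring).
  apply Rmult_le_compat_l; [easy|].
  unfold sinh_weight, cosh_weight; lra.
Qed.

(** A state is a family of reals indexed by [I], measured by the supremum of its entries; the
    upper bound [D] in the Lipschitz clause stands for that supremum.  Continuity is required along continuous paths, which is the only way in which
    it enters an integral equation. *)
Definition bounded_lipschitz_field {I : Type} (L M : R) (F : R -> (I -> R) -> I -> R) : Prop :=
  (forall s x i, Rabs (F s x i) <= M) /\
  (forall s x y D, (forall i, Rabs (x i - y i) <= D) ->
     forall i, Rabs (F s x i - F s y i) <= L * D) /\
  (forall u : I -> R -> R, (forall i s, continuous (u i) s) ->
     forall i s, continuous (fun r => F r (fun j => u j r) i) s).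

Fixpoint picard {I : Type} (F : R -> (I -> R) -> I -> R) (t : R) (x0 : I -> R) (n : nat)
    : I -> R -> R :=
  match n with
  | O => fun i _ => x0 i
  | S n => fun i s => x0 i + RInt (fun r => F r (fun j => picard F t x0 n j r) i) t s
  end.

Lemma is_derive_primitive (g : R -> R) (c t s : R) :
  (forall r, continuous g r) -> is_derive (fun s => c + RInt g t s) s (g s).
Proof.
intros hg.
replace (g s) with (plus zero (g s)) by apply plus_zero_l.
apply (is_derive_plus (fun _ => c) (RInt g t)); [apply (is_derive_const c)|].
apply (is_derive_RInt g (RInt g t) t); [|apply hg].
apply filter_forall; intros b; apply (RInt_correct g), (ex_RInt_continuous g); auto.
Qed.

Lemma is_derive_continuous (f : R -> R) (x l : R) : is_derive f x l -> continuous f x.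
Proof. intros h; apply (ex_derive_continuous f); now exists l. Qed.

Lemma pow_half_pos (n : nat) : 0 < (1 / 2) ^ n.
Proof. apply pow_lt; lra. Qed.

Lemma squeeze_pow_half (a K : R) :
  (forall n, Rabs a <= K * (1 / 2) ^ n) -> a = 0.
Proof.
intros h.
assert (hl : is_lim_seq (fun n => K * (1 / 2) ^ n) 0).
{ replace (Finite 0) with (Rbar_mult K 0) by (simpl; f_equal; ring).
  apply is_lim_seq_scal_l, is_lim_seq_geom; rewrite Rabs_pos_eq; lra. }
assert (h0 : Rbar_le (Rabs a) 0).
{ apply (is_lim_seq_le (fun _ => Rabs a) (fun n => K * (1 / 2) ^ n)); auto.
  apply is_lim_seq_const. }
simpl in h0; assert (h1 := Rabs_pos a).
apply Rabs_eq_0; lra.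
Qed.

(** The telescoped increments are dominated by a geometric series; the explicit rate is kept
    because it has to be uniform in the time variable later on. *)
Lemma geometric_cauchy_limit (a : nat -> R) (K : R) :
  (forall n, Rabs (a (S n) - a n) <= K * (1 / 2) ^ n) ->
  exists l : R, is_lim_seq a l /\ forall n, Rabs (l - a n) <= 2 * K * (1 / 2) ^ n.
Proof.
intros h.
assert (hK : 0 <= K).
{ assert (h0 := h O); assert (h1 := Rabs_pos (a 1%nat - a 0%nat)); simpl in h0; lra. }
assert (hd : forall n k, Rabs (a (n + k)%nat - a n) <= 2 * K * (1 / 2) ^ n * (1 - (1 / 2) ^ k)).
{ intros n k; induction k as [|k IH].
  - rewrite Nat.add_0_r, Rminus_diag, Rabs_R0; simpl; lra.
  - rewrite <- plus_n_Sm.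
    replace (a (S (n + k)) - a n) with ((a (S (n + k)) - a (n + k)%nat) + (a (n + k)%nat - a n))
      by ring.
    apply Rle_trans with (1 := Rabs_triang _ _).
    assert (h1 := h (n + k)%nat); rewrite pow_add in h1; simpl; nra. }
assert (hb : forall n k, Rabs (a (n + k)%nat - a n) <= 2 * K * (1 / 2) ^ n).
{ intros n k; apply Rle_trans with (1 := hd n k).
  assert (h1 := pow_half_pos n); assert (h2 := pow_half_pos k).
  assert (0 <= 2 * K * (1 / 2) ^ n) by (apply Rmult_le_pos; lra).
  rewrite <- (Rmult_1_r (2 * K * (1 / 2) ^ n)) at 2.
  apply Rmult_le_compat_l; lra. }
assert (hl : is_lim_seq (fun n => 2 * K * (1 / 2) ^ n) 0).
{ replace (Finite 0) with (Rbar_mult (2 * K) 0) by (simpl; f_equal; ring).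
  apply is_lim_seq_scal_l, is_lim_seq_geom; rewrite Rabs_pos_eq; lra. }
assert (hc : ex_finite_lim_seq a).
{ apply ex_lim_seq_cauchy_corr; intros eps.
  apply is_lim_seq_spec in hl; destruct (hl (pos_div_2 eps)) as [N hN].
  exists N; intros n m hn hm.
  (* Both terms are compared with the [N]-th one. *)
  replace n with (N + (n - N))%nat by lia; replace m with (N + (m - N))%nat by lia.
  assert (h1 := hb N (n - N)%nat); assert (h2 := hb N (m - N)%nat).
  assert (h3 := hN N (le_n _)); rewrite Rminus_0_r in h3; simpl in h3.
  assert (h4 := Rle_abs (2 * K * (1 / 2) ^ N)).
  replace (a (N + (n - N))%nat - a (N + (m - N))%nat)
    with ((a (N + (n - N))%nat - a N) - (a (N + (m - N))%nat - a N)) by ring.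
  apply Rle_lt_trans with (1 := Rabs_triang _ _); rewrite Rabs_Ropp; simpl; lra. }
destruct hc as [l hl']; exists l; split; [easy|]; intros n.
assert (h0 : Rbar_le (Rabs (l - a n)) (2 * K * (1 / 2) ^ n)); [|exact h0].
apply (is_lim_seq_le (fun k => Rabs (a (n + k)%nat - a n)) (fun _ => 2 * K * (1 / 2) ^ n)).
- apply hb.
- apply (is_lim_seq_abs (fun k => a (n + k)%nat - a n) (l - a n)).
  apply is_lim_seq_minus'; [|apply is_lim_seq_const].
  apply (is_lim_seq_ext (fun k => a (k + n)%nat)); [intros k; f_equal; lia|].
  now apply (is_lim_seq_incr_n a).
- apply is_lim_seq_const.
Qed.

(** Global Picard-Lindelof theorem.  By [cosh_weight_absorbs] the increments of the iterates decay
    like [2^-n] times the weight, hence converge at every time; boundedness of the field makes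
    all the iterates, and so the limit, Lipschitz in time.  The limit is a fixed point since its
    distance to its own Picard image is smaller than every multiple of [2^-n]. *)
Lemma picard_existence {I : Type} (L M : R) (F : R -> (I -> R) -> I -> R) (t : R) (x0 : I -> R) :
  0 < L -> bounded_lipschitz_field L M F ->
  exists u : I -> R -> R,
    (forall i, u i t = x0 i) /\
    (forall i s, is_derive (u i) s (F s (fun j => u j s) i)).
Proof.
intros hL [hM [hLip hcont]].
set (p := picard F t x0).
assert (hpc : forall n i s, continuous (p n i) s).
{ induction n as [|n IH]; intros i s; [apply continuous_const|].
  eapply is_derive_continuous, is_derive_primitive; intros r.
  now apply hcont. }
assert (hpd : forall n i s, is_derive (p (S n) i) s (F s (fun j => p n j s) i)).
{ intros n i s; apply (is_derive_primitive (fun r => F r (fun j => p n j r) i)).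
  intros r; now apply hcont. }
assert (hp0 : forall n i, p n i t = x0 i).
{ intros [|n] i; [easy|]; change (x0 i + RInt (fun r => F r (fun j => p n j r) i) t t = x0 i).
  rewrite RInt_point; apply Rplus_0_r. }
assert (hstep : forall n i s,
  Rabs (p (S n) i s - p n i s) <= M / (2 * L) * cosh_weight L t s * (1 / 2) ^ n).
{ intros n; induction n as [|n IH]; intros i s.
  - rewrite pow_O, Rmult_1_r.
    assert (hM0 : 0 <= M) by (apply Rle_trans with (2 := hM 0 x0 i), Rabs_pos).
    apply (cosh_weight_absorbs L t s M (fun r => p 1%nat i r - p 0%nat i r)
             (fun r => F r (fun j => p 0%nat j r) i - 0)); auto.
    + rewrite !hp0; ring.
    + intros r _; apply (is_derive_minus (p 1%nat i) (p 0%nat i)); [apply hpd|].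
      apply (is_derive_const (x0 i)).
    + intros r _; apply (continuous_minus (p 1%nat i) (p 0%nat i)); apply hpc.
    + intros r _; rewrite Rminus_0_r; apply Rle_trans with (1 := hM _ _ _).
      assert (h := cosh_weight_ge_1 L t r); nra.
  - assert (hM0 : 0 <= M) by (apply Rle_trans with (2 := hM 0 x0 i), Rabs_pos).
    assert (hn := pow_half_pos n).
    replace (M / (2 * L) * cosh_weight L t s * (1 / 2) ^ S n)
      with ((M / 2 * (1 / 2) ^ n) / (2 * L) * cosh_weight L t s) by (simpl; field; lra).
    apply (cosh_weight_absorbs L t s (M / 2 * (1 / 2) ^ n)
             (fun r => p (S (S n)) i r - p (S n) i r)
             (fun r => F r (fun j => p (S n) j r) i - F r (fun j => p n j r) i)); auto.
    + apply Rmult_le_pos; lra.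
    + rewrite !hp0; ring.
    + intros r _; apply (is_derive_minus (p (S (S n)) i) (p (S n) i)); apply hpd.
    + intros r _; apply (continuous_minus (p (S (S n)) i) (p (S n) i)); apply hpc.
    + intros r _.
      apply Rle_trans with (L * (M / (2 * L) * cosh_weight L t r * (1 / 2) ^ n)).
      * apply hLip; intros j; apply IH.
      * right; field; lra. }
set (u := fun i s => real (Lim_seq (fun n => p n i s))).
assert (hu : forall i s, is_lim_seq (fun n => p n i s) (u i s) /\
  forall n, Rabs (u i s - p n i s) <= 2 * (M / (2 * L) * cosh_weight L t s) * (1 / 2) ^ n).
{ intros i s.
  destruct (geometric_cauchy_limit (fun n => p n i s) _ (fun n => hstep n i s)) as [l [h1 h2]].
  unfold u; rewrite (is_lim_seq_unique _ _ h1); split; [exact h1|exact h2]. }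
assert (huc : forall i s, continuous (u i) s).
{ intros i s; apply lipschitz_continuous with M; intros s'.
  assert (hM0 : 0 <= M) by (apply Rle_trans with (2 := hM 0 x0 i), Rabs_pos).
  assert (hlip : forall n a b, a <= b -> Rabs (p n i b - p n i a) <= M * (b - a)).
  { intros [|n] a b hab.
    - change (Rabs (x0 i - x0 i) <= M * (b - a)).
      rewrite Rminus_diag, Rabs_R0; apply Rmult_le_pos; lra.
    - replace (M * (b - a)) with (M * b - M * a) by ring.
      apply (derive_le_increment _ (fun r => F r (fun j => p n j r) i)
               (fun r => M * r) (fun _ => M)); auto.
      + intros r _; (auto_derive; [exact Logic.I|ring]).
      + intros r _; apply (is_derive_continuous _ _ M); auto_derive; [easy|ring]. }
  assert (h0 : Rbar_le (Rabs (u i s' - u i s)) (M * Rabs (s' - s))); [|exact h0].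
  apply (is_lim_seq_le (fun n => Rabs (p n i s' - p n i s)) (fun _ => M * Rabs (s' - s))).
  - intros n; destruct (Rle_dec s s').
    + rewrite (Rabs_pos_eq (s' - s)) by lra; now apply hlip.
    + rewrite (Rabs_minus_sym s' s), (Rabs_minus_sym (p n i s')), (Rabs_pos_eq (s - s')) by lra.
      apply hlip; lra.
  - apply (is_lim_seq_abs (fun n => p n i s' - p n i s) (u i s' - u i s)).
    apply is_lim_seq_minus'; apply hu.
  - apply is_lim_seq_const. }
assert (hfix : forall i s, u i s = x0 i + RInt (fun r => F r (fun j => u j r) i) t s).
{ intros i s; apply Rminus_diag_uniq.
  assert (hM0 : 0 <= M) by (apply Rle_trans with (2 := hM 0 x0 i), Rabs_pos).
  apply (squeeze_pow_half _ (2 * (M / (2 * L) * cosh_weight L t s))); intros n.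
  set (v := fun s => x0 i + RInt (fun r => F r (fun j => u j r) i) t s).
  change (Rabs (u i s - v s) <= 2 * (M / (2 * L) * cosh_weight L t s) * (1 / 2) ^ n).
  assert (hv : forall r, is_derive v r (F r (fun j => u j r) i)).
  { intros r; apply (is_derive_primitive (fun r => F r (fun j => u j r) i)).
    intros r'; now apply hcont. }
  assert (h1 := proj2 (hu i s) (S n)).
  assert (hn := pow_half_pos n).
  assert (h2 : Rabs (v s - p (S n) i s) <= (M * (1 / 2) ^ n) / (2 * L) * cosh_weight L t s).
  { apply (cosh_weight_absorbs L t s _ (fun r => v r - p (S n) i r)
             (fun r => F r (fun j => u j r) i - F r (fun j => p n j r) i)); auto.
    - apply Rmult_le_pos; lra.
    - rewrite hp0; unfold v; rewrite RInt_point; change (x0 i + 0 - x0 i = 0); ring.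
    - intros r _; apply (is_derive_minus v (p (S n) i)); [apply hv|apply hpd].
    - intros r _; apply (continuous_minus v (p (S n) i)); [|apply hpc].
      eapply is_derive_continuous, hv.
    - intros r _.
      apply Rle_trans with (L * (2 * (M / (2 * L) * cosh_weight L t r) * (1 / 2) ^ n)).
      + apply hLip; intros j; apply hu.
      + right; field; lra. }
  replace (u i s - v s) with ((u i s - p (S n) i s) - (v s - p (S n) i s)) by ring.
  apply Rle_trans with (1 := Rabs_triang _ _); rewrite Rabs_Ropp.
  apply Rle_trans with (1 := Rplus_le_compat _ _ _ _ h1 h2).
  right; simpl; field; lra. }
exists u; split.
- intros i; rewrite hfix, RInt_point; apply Rplus_0_r.
- intros i s.
  apply is_derive_ext with (fun s => x0 i + RInt (fun r => F r (fun j => u j r) i) t s).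
  + intros r; symmetry; apply hfix.
  + apply (is_derive_primitive (fun r => F r (fun j => u j r) i)); intros r.
    now apply hcont.
Qed.

(** The gap between two solutions is at most a multiple of the weight because the field is
    bounded, and each use of the Lipschitz estimate halves this multiple. *)
Lemma bounded_lipschitz_uniqueness {I : Type} (L M : R) (F : R -> (I -> R) -> I -> R)
    (a b t : R) (u v : I -> R -> R) :
  0 < L -> bounded_lipschitz_field L M F -> closed_interval a b t ->
  (forall i s, a <= s <= b -> continuous (u i) s) ->
  (forall i s, a <= s <= b -> continuous (v i) s) ->
  (forall i s, a < s < b -> is_derive (u i) s (F s (fun j => u j s) i)) ->
  (forall i s, a < s < b -> is_derive (v i) s (F s (fun j => v j s) i)) ->
  (forall i, u i t = v i t) ->
  forall i s, a <= s <= b -> u i s = v i s.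
Proof.
intros hL [hM [hLip _]] [hat htb] uc vc du dv e i s hs.
assert (hM0 : 0 <= M) by (apply Rle_trans with (2 := hM 0 (fun _ => 0) i), Rabs_pos).
assert (hb : forall n j r, a <= r <= b ->
  Rabs (u j r - v j r) <= M / L * cosh_weight L t r * (1 / 2) ^ n).
{ assert (hbetween : forall r q, a <= r <= b -> Rmin t r < q < Rmax t r -> a < q < b).
  { intros r q hr; unfold Rmin, Rmax; destruct (Rle_dec t r); lra. }
  assert (hbetween' : forall r q, a <= r <= b -> Rmin t r <= q <= Rmax t r -> a <= q <= b).
  { intros r q hr; unfold Rmin, Rmax; destruct (Rle_dec t r); lra. }
  induction n as [|n IH]; intros j r hr.
  - replace (M / L * cosh_weight L t r * (1 / 2) ^ 0)
      with ((2 * M) / (2 * L) * cosh_weight L t r) by (simpl; field; lra).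
    apply (cosh_weight_absorbs L t r (2 * M) (fun r => u j r - v j r)
             (fun r => F r (fun j => u j r) j - F r (fun j => v j r) j)); auto.
    + lra.
    + rewrite e; ring.
    + intros q hq; apply (is_derive_minus (u j) (v j)); [apply du|apply dv]; eauto.
    + intros q hq; apply (continuous_minus (u j) (v j)); [apply uc|apply vc]; eauto.
    + intros q _; apply Rle_trans with (1 := Rabs_triang _ _); rewrite Rabs_Ropp.
      assert (h1 := hM q (fun j => u j q) j); assert (h2 := hM q (fun j => v j q) j).
      assert (h := cosh_weight_ge_1 L t q); nra.
  - assert (hn := pow_half_pos n).
    replace (M / L * cosh_weight L t r * (1 / 2) ^ S n)
      with ((M * (1 / 2) ^ n) / (2 * L) * cosh_weight L t r) by (simpl; field; lra).
    apply (cosh_weight_absorbs L t r (M * (1 / 2) ^ n) (fun r => u j r - v j r)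
             (fun r => F r (fun j => u j r) j - F r (fun j => v j r) j)); auto.
    + apply Rmult_le_pos; lra.
    + rewrite e; ring.
    + intros q hq; apply (is_derive_minus (u j) (v j)); [apply du|apply dv]; eauto.
    + intros q hq; apply (continuous_minus (u j) (v j)); [apply uc|apply vc]; eauto.
    + intros q hq.
      apply Rle_trans with (L * (M / L * cosh_weight L t q * (1 / 2) ^ n)).
      * apply hLip; intros k; apply IH; apply (hbetween' r); [easy|lra].
      * right; field; lra. }
apply Rminus_diag_uniq, (squeeze_pow_half _ (M / L * cosh_weight L t s)).
intros n; now apply hb.
Qed.

(** * Derivatives relative to an interval *)

Lemma locally_open_interval (a b s : R) : a < s < b -> locally s (fun r => a < r < b).
Proof. intros h; apply filter_and; [apply open_gt|apply open_lt]; apply h. Qed.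

Lemma is_derive_in_interior (a b : R) (f : R -> R) (s l : R) :
  a < s < b -> is_derive_in (closed_interval a b) f s l -> is_derive f s l.
Proof.
intros hs [hlin hdom]; split; [apply is_linear_scal_l|].
intros x hx eps.
assert (hx' : is_filter_lim (within (closed_interval a b) (locally s)) x).
{ intros P hP; unfold within; generalize (hx P hP); apply filter_imp; auto. }
assert (h := hdom x hx' eps).
assert (hi := locally_open_interval a b s hs).
unfold within in h.
generalize (filter_and _ _ h hi); apply filter_imp; intros r [h1 h2].
apply h1; unfold closed_interval; lra.
Qed.

(** The definition of differentiability along a filter quantifies over all its limit points; the
    point to be checked is that the relative neighbourhoods of [s] have no other limit than [s],
    which holds because [s] belongs to all of them. *)
Lemma is_derive_is_derive_in (D : R -> Prop) (f : R -> R) (s l : R) :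
  D s -> is_derive f s l -> is_derive_in D f s l.
Proof.
intros hs [hlin hdom]; split; [exact hlin|].
intros x hx.
assert (e : x = s).
{ apply Rminus_diag_uniq, (squeeze_pow_half _ 1); intros n.
  assert (h := hx _ (locally_ball x (mkposreal _ (pow_half_pos n)))).
  assert (h1 := locally_singleton _ _ h hs).
  change (Rabs (s - x) < (1 / 2) ^ n) in h1; rewrite Rabs_minus_sym; lra. }
rewrite e; intros eps; unfold within.
assert (h := hdom s (fun P hP => hP) eps); revert h; apply filter_imp; auto.
Qed.

Lemma continuous_on_comp {T U V : UniformSpace} (D : U -> Prop) (f : U -> V) (g : T -> U) (x : T) :
  continuous_on D f -> continuous g x -> (forall y, D (g y)) -> continuous (fun y => f (g y)) x.
Proof.
intros hf hg hD.
apply (filterlim_comp _ _ _ g f _ (within D (locally (g x)))); [|now apply hf].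
intros P hP; generalize (hg _ hP); unfold filtermap; apply filter_imp; auto.
Qed.

(** Freezing a function beyond the ends of the interval turns continuity relative to [a, b] into
    continuity on the line, so that the mean value inequalities apply up to the endpoints. *)
Lemma continuous_clamped (a b : R) (f : R -> R) (s : R) :
  a <= b -> continuous_on (closed_interval a b) f -> continuous (fun r => f (clamp a b r)) s.
Proof.
intros hab hf; apply (continuous_on_comp (closed_interval a b) f); auto.
- apply clamp_continuous.
- intros y; now apply clamp_in.
Qed.

Lemma is_derive_clamped (a b : R) (f : R -> R) (s l : R) :
  a < s < b -> is_derive f s l -> is_derive (fun r => f (clamp a b r)) s l.
Proof.
intros hs; apply is_derive_ext_loc.
generalize (locally_open_interval a b s hs); apply filter_imp; intros r hr.
rewrite clamp_id; [easy|unfold closed_interval; lra].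
Qed.

Lemma derive_bounded_increment (f f' : R -> R) (a b K : R) :
  0 <= K ->
  (forall r, a < r < b -> is_derive f r (f' r)) ->
  (forall r, a <= r <= b -> continuous f r) ->
  (forall r, a < r < b -> Rabs (f' r) <= K) ->
  forall s t, a <= s <= b -> a <= t <= b -> Rabs (f s - f t) <= K * Rabs (s - t).
Proof.
intros hK df cf hf.
assert (key : forall s t, a <= s <= b -> a <= t <= b -> t <= s -> Rabs (f s - f t) <= K * (s - t)).
{ intros s t hs ht hts; replace (K * (s - t)) with (K * s - K * t) by ring.
  apply (derive_le_increment f f' (fun r => K * r) (fun _ => K)); auto.
  - intros r hr; apply df; lra.
  - intros r hr; apply cf; lra.
  - intros r _; auto_derive; [exact Logic.I|ring].
  - intros r _; apply (is_derive_continuous _ _ K); auto_derive; [exact Logic.I|ring].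
  - intros r hr; apply hf; lra. }
intros s t hs ht; destruct (Rle_dec t s).
- rewrite (Rabs_pos_eq (s - t)) by lra; auto.
- rewrite (Rabs_minus_sym (f s)), (Rabs_minus_sym s), (Rabs_pos_eq (t - s)) by lra.
  apply key; lra.
Qed.

(** Points of the closed interval are approached by moving them towards the midpoint. *)
Lemma oscillation_closure (f : R -> R) (a b K : R) :
  a < b -> (forall r, a <= r <= b -> continuous f r) ->
  (forall s t, a < s < b -> a < t < b -> Rabs (f s - f t) <= K) ->
  forall s t, a <= s <= b -> a <= t <= b -> Rabs (f s - f t) <= K.
Proof.
intros hab cf h.
(* The exponent [S n] keeps the contraction factor below one, so that [q s n] is interior. *)
set (q := fun (s : R) n => s + ((a + b) / 2 - s) * (1 / 2) ^ S n).
assert (hq : forall s n, a <= s <= b -> a < q s n < b).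
{ intros s n hs; unfold q.
  assert (h1 := pow_half_pos (S n)).
  assert (h2 : (1 / 2) ^ S n < 1) by (apply pow_lt_1_compat; [lra|lia]).
  set (y := (1 / 2) ^ S n) in *; split; nra. }
assert (hl : forall s, a <= s <= b -> is_lim_seq (fun n => f (q s n)) (f s)).
{ intros s hs; apply is_lim_seq_continuous; [now apply continuity_pt_filterlim, cf|].
  unfold q; replace (Finite s) with (Finite (s + ((a + b) / 2 - s) * 0)) by (f_equal; ring).
  apply is_lim_seq_plus'; [apply is_lim_seq_const|].
  apply is_lim_seq_mult'; [apply is_lim_seq_const|].
  apply (is_lim_seq_incr_1 (fun n => (1 / 2) ^ n)), is_lim_seq_geom.
  rewrite Rabs_pos_eq; lra. }
intros s t hs ht.
assert (h0 : Rbar_le (Rabs (f s - f t)) K); [|exact h0].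
apply (is_lim_seq_le (fun n => Rabs (f (q s n) - f (q t n))) (fun _ => K)).
- intros n; apply h; auto.
- apply (is_lim_seq_abs (fun n => f (q s n) - f (q t n)) (f s - f t)).
  apply is_lim_seq_minus'; auto.
- apply is_lim_seq_const.
Qed.

(** * The confining potential and the potential of the internal field *)

(** The lower bound on [psi] blows up at the boundary, so a bound [K] on [psi] inverts to the
    lower bound [(c0 / (K + 1 / c0)) ^ (1 / gamma)] on the distance to the boundary. *)
Lemma potential_barrier (psi : R -> R) (gamma c0 K : R) :
  0 < gamma -> 0 < c0 -> 0 <= K ->
  (forall x, Omega x ->
     Rabs (psi x) >= c0 / Rpower (dist_set x (boundary Omega)) gamma - 1 / c0) ->
  exists rho, 0 < rho /\ forall x, Omega x -> Rabs (psi x) <= K -> rho <= x <= 1 - rho.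
Proof.
intros hg hc hK hconf.
assert (hc' : 0 < 1 / c0) by (apply Rdiv_lt_0_compat; lra).
set (m := c0 / (K + 1 / c0)).
assert (hm : 0 < m) by (apply Rdiv_lt_0_compat; lra).
exists (Rpower m (1 / gamma)); split; [apply exp_pos|].
intros x hx hpsi; assert (h := hconf x hx).
rewrite dist_boundary_Omega in h by easy.
unfold Omega in hx.
assert (hd : 0 < Rmin x (1 - x)) by (apply Rmin_pos; lra).
assert (Rpower m (1 / gamma) <= Rmin x (1 - x)).
{ apply Rnot_lt_le; intros hlt.
  assert (h1 : Rpower (Rmin x (1 - x)) gamma < Rpower (Rpower m (1 / gamma)) gamma)
    by (apply Rlt_Rpower_l; lra).
  rewrite Rpower_mult in h1; replace (1 / gamma * gamma) with 1 in h1 by (field; lra).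
  rewrite Rpower_1 in h1 by easy.
  set (p := Rpower (Rmin x (1 - x)) gamma) in *.
  assert (hp : 0 < p) by apply exp_pos.
  assert (h2 : c0 / p <= K + 1 / c0) by lra.
  assert (h3 : c0 <= (K + 1 / c0) * p).
  { apply (Rmult_le_compat_r p) in h2; [|lra].
    replace (c0 / p * p) with c0 in h2 by (field; lra); lra. }
  assert (h4 : (K + 1 / c0) * m = c0) by (unfold m; field; split; [|nra]; lra).
  nra. }
assert (h1 := Rmin_l x (1 - x)); assert (h2 := Rmin_r x (1 - x)); lra.
Qed.

Lemma strip_interior (T s y : R) : 0 < s < T -> Omega y -> locally (s, y) (strip T).
Proof.
intros hs hy.
assert (h : filter_prod (locally s) (locally y) (strip T)).
{ exists (fun r => 0 < r < T) (fun z => 0 < z < 1).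
  - now apply locally_open_interval.
  - now apply locally_open_interval.
  - intros r z hr hz; split; [unfold closed_interval; simpl; lra|exact hz]. }
destruct h as [P Q [e1 h1] [e2 h2] h].
exists (mkposreal _ (Rmin_stable_in_posreal e1 e2)); intros [r z] [hr hz]; apply h.
- apply h1; apply (ball_le s _ e1 (Rmin_l e1 e2)); exact hr.
- apply h2; apply (ball_le y _ e2 (Rmin_r e1 e2)); exact hz.
Qed.

Lemma strip_continuous_2d (T : R) (f : R -> R -> R) (s y : R) :
  continuous_on (strip T) (fun p => f (fst p) (snd p)) -> 0 < s < T -> Omega y ->
  continuity_2d_pt f s y.
Proof.
intros hf hs hy; apply continuity_2d_pt_filterlim.
apply (continuous_continuous_on (strip T) (fun p => f (fst p) (snd p)) (s, y)); auto.
now apply strip_interior.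
Qed.

Lemma strip_slice_continuous (T : R) (f : R -> R -> R) (s y : R) :
  C1_strip T f -> closed_interval 0 T s -> Omega y -> continuous (f s) y.
Proof.
intros [fs [fy [h _]]] hs hy; eapply is_derive_continuous; now apply h.
Qed.

Lemma Omega_between (x y z : R) : Omega x -> Omega y -> Rmin x y <= z <= Rmax x y -> Omega z.
Proof. unfold Omega, Rmin, Rmax; destruct (Rle_dec x y); lra. Qed.

Lemma Omega_half : Omega (1 / 2).
Proof. unfold Omega; lra. Qed.

Lemma ex_RInt_slice (T : R) (f : R -> R -> R) (s x y : R) :
  C1_strip T f -> closed_interval 0 T s -> Omega x -> Omega y -> ex_RInt (f s) x y.
Proof.
intros hf hs hx hy; apply (ex_RInt_continuous (f s)); intros z hz.
apply strip_slice_continuous with T; auto; now apply (Omega_between x y).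
Qed.

(** [RInt (B r) (1/2) y] is a potential of the internal field: its [y]-derivative is [B], and
    differentiating under the integral sign and inserting Faraday's law [B_t = - (E2)_y] turns
    its time derivative into the increment of [- E2] between [1/2] and [y]. *)
Lemma is_derive_vector_potential (T : R) (E2 B : R -> R -> R) (X : R -> R) (s dX : R) :
  C1_strip T E2 -> C1_strip T B ->
  (forall s y, closed_interval 0 T s -> Omega y ->
     is_derive_in (closed_interval 0 T) (fun s' => B s' y) s (- Derive (fun y' => E2 s y') y)) ->
  0 < s < T -> Omega (X s) -> is_derive X s dX ->
  is_derive (fun r => RInt (B r) (1 / 2) (X r)) s
    (E2 s (1 / 2) - E2 s (X s) + B s (X s) * dX).
Proof.
intros hE2 hB hF hs hX hdX.
destruct hE2 as [es [ey [hE [_ [_ hey]]]]].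
assert (hclosed : forall r, 0 < r < T -> closed_interval 0 T r)
  by (unfold closed_interval; intros; lra).
assert (hsnear := locally_open_interval 0 T s hs).
assert (hXnear : locally s (fun r => Omega (X r))).
{ apply (is_derive_continuous X s dX hdX (fun y => Omega y)).
  now apply locally_open_interval. }
assert (hBt : forall r y, 0 < r < T -> Omega y -> is_derive (fun u => B u y) r (- ey r y)).
{ intros r y hr hy.
  replace (ey r y) with (Derive (fun y' => E2 r y') y)
    by (apply is_derive_unique, hE; auto).
  apply (is_derive_in_interior 0 T); auto. }
assert (hcont : forall r y, 0 < r < T -> Omega y ->
  continuity_2d_pt (fun u v => Derive (fun z => B z v) u) r y).
{ intros r y hr hy.
  apply continuity_2d_pt_ext_loc with (fun u v => - ey u v).
  - destruct (strip_interior T r y hr hy) as [e1 h1].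
    destruct (locally_open_interval 0 T r hr) as [e2 h2].
    exists (mkposreal _ (Rmin_stable_in_posreal e1 e2)); simpl; intros u v hu hv.
    symmetry; apply is_derive_unique, hBt.
    + apply h2; apply Rlt_le_trans with (1 := hu), Rmin_r.
    + apply (h1 (u, v)); split.
      * apply Rlt_le_trans with (1 := hu), Rmin_l.
      * apply Rlt_le_trans with (1 := hv), Rmin_l.
  - apply continuity_2d_pt_opp, strip_continuous_2d with T; auto. }
(* [e] leaves a whole interval around [X s] inside the gap, where [B] is differentiable in time. *)
set (e := Rmin (X s) (1 - X s) / 2).
assert (he : 0 < e).
{ unfold e; apply Rdiv_lt_0_compat; [|lra]; unfold Omega in hX; apply Rmin_pos; lra. }
assert (he1 : 2 * e <= X s) by (unfold e; assert (h := Rmin_l (X s) (1 - X s)); lra).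
assert (he2 : 2 * e <= 1 - X s) by (unfold e; assert (h := Rmin_r (X s) (1 - X s)); lra).
replace (E2 s (1 / 2) - E2 s (X s) + B s (X s) * dX)
  with (RInt (fun y => Derive (fun u => B u y) s) (1 / 2) (X s) + B s (X s) * dX).
2:{ f_equal.
  replace (E2 s (1 / 2) - E2 s (X s)) with (opp (minus (E2 s (X s)) (E2 s (1 / 2))))
    by (change (- (E2 s (X s) - E2 s (1 / 2)) = E2 s (1 / 2) - E2 s (X s)); ring).
  apply is_RInt_unique.
  apply is_RInt_ext with (fun y => opp (ey s y)).
  - intros y hy; symmetry; apply is_derive_unique, hBt; auto.
    apply (Omega_between (1 / 2) (X s)); auto using Omega_half; lra.
  - apply (is_RInt_opp (ey s)), (is_RInt_derive (E2 s)).
    + intros y hy; apply hE; auto.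
      apply (Omega_between (1 / 2) (X s)); auto using Omega_half.
    + intros y hy; apply (continuity_pt_filterlim (ey s)).
      assert (h2d : continuity_2d_pt ey s y).
      { apply strip_continuous_2d with T; auto.
        apply (Omega_between (1 / 2) (X s)); auto using Omega_half. }
      intros eps heps; destruct (h2d (mkposreal eps heps)) as [d hd].
      exists d; split; [apply cond_pos|]; intros z [_ hz].
      apply hd; [rewrite Rminus_diag, Rabs_R0; apply cond_pos|exact hz]. }
apply is_derive_RInt_param_bound_comp_aux3; auto.
- generalize hsnear; apply filter_imp; intros r hr.
  apply (ex_RInt_slice T B); auto using Omega_half.
- exists (mkposreal e he); generalize hsnear; apply filter_imp; intros r hr; simpl.
  apply (ex_RInt_slice T B); auto; unfold Omega; lra.
- exists (mkposreal e he); generalize hsnear; apply filter_imp; intros r hr y hy; simpl in hy.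
  eexists; apply hBt; auto.
  unfold Omega; unfold Rmin, Rmax in hy.
  destruct (Rle_dec _ _), (Rle_dec _ _); lra.
- intros y hy; apply hcont; auto.
  apply (Omega_between (1 / 2) (X s)); auto using Omega_half.
- destruct (strip_interior T s (X s) hs hX) as [e1 h1].
  destruct hsnear as [e2 h2].
  exists (mkposreal _ (Rmin_stable_in_posreal e1 e2)); simpl; intros u v hu hv.
  apply hcont.
  + apply h2; apply Rlt_le_trans with (1 := hu), Rmin_r.
  + apply (h1 (u, v)); split.
    * apply Rlt_le_trans with (1 := hu), Rmin_l.
    * apply Rlt_le_trans with (1 := hv), Rmin_l.
- apply continuity_pt_filterlim; apply strip_slice_continuous with T; auto.
Qed.

(** * A priori bounds along characteristics *)

(** The factor by which a momentum is divided to obtain the relativistic velocity. *)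
Definition lorentz (a b : R) : R := sqrt (1 + (a ^ 2 + b ^ 2)).

Lemma lorentz_sqr (a b : R) : lorentz a b ^ 2 = 1 + (a ^ 2 + b ^ 2).
Proof. unfold lorentz; rewrite pow2_sqrt; nra. Qed.

Lemma lorentz_ge_1 (a b : R) : 1 <= lorentz a b.
Proof.
unfold lorentz; rewrite <- sqrt_1 at 1; apply sqrt_le_1_alt; nra.
Qed.

Lemma abs_le_lorentz (a b : R) : Rabs a <= lorentz a b /\ Rabs b <= lorentz a b.
Proof.
assert (h := lorentz_sqr a b); assert (h1 := lorentz_ge_1 a b).
split; apply Rabs_le; nra.
Qed.

Lemma hat1_eq (a b : R) : hat1 (a, b) = a / lorentz a b.
Proof.
unfold hat1, lorentz; rewrite norm2_eq, pow2_sqrt by nra; reflexivity.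
Qed.

Lemma hat2_eq (a b : R) : hat2 (a, b) = b / lorentz a b.
Proof.
unfold hat2, lorentz; rewrite norm2_eq, pow2_sqrt by nra; reflexivity.
Qed.

Lemma abs_le_norm2 (a b : R) : Rabs a <= norm2 (a, b) /\ Rabs b <= norm2 (a, b).
Proof.
rewrite norm2_eq.
assert (h0 := sqrt_pos (a ^ 2 + b ^ 2)).
assert (h1 : sqrt (a ^ 2 + b ^ 2) ^ 2 = a ^ 2 + b ^ 2) by (apply pow2_sqrt; nra).
split; apply Rabs_le; nra.
Qed.

(** The characteristic equations on a subinterval, with two-sided derivatives inside and mere
    continuity at the ends; unlike [is_characteristic] it can be restricted to the part of a
    path that is already known to stay in the gap. *)
Definition solves_on (a b : R) (E1 E2 B : R -> R -> R) (Bext X V1 V2 : R -> R) : Prop :=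
  (forall s, a <= s <= b ->
     Omega (X s) /\ continuous X s /\ continuous V1 s /\ continuous V2 s) /\
  (forall s, a < s < b ->
     is_derive X s (hat1 (V1 s, V2 s)) /\
     is_derive V1 s (E1 s (X s) + hat2 (V1 s, V2 s) * (B s (X s) + Bext (X s))) /\
     is_derive V2 s (E2 s (X s) - hat1 (V1 s, V2 s) * (B s (X s) + Bext (X s)))).

Lemma is_derive_lorentz (V1 V2 : R -> R) (s d1 d2 : R) :
  is_derive V1 s d1 -> is_derive V2 s d2 ->
  is_derive (fun r => lorentz (V1 r) (V2 r)) s
    ((V1 s * d1 + V2 s * d2) / lorentz (V1 s) (V2 s)).
Proof.
intros h1 h2; unfold lorentz.
assert (hp : 0 < 1 + (V1 s ^ 2 + V2 s ^ 2)) by nra.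
auto_derive.
- repeat split; [now exists d1|now exists d2|]. simpl in hp; lra.
- replace (Derive (fun x => V1 x) s) with d1 by (symmetry; now apply is_derive_unique).
  replace (Derive (fun x => V2 x) s) with d2 by (symmetry; now apply is_derive_unique).
  simpl; simpl in hp; field.
  apply Rgt_not_eq, sqrt_lt_R0; lra.
Qed.

Lemma continuous_lorentz (V1 V2 : R -> R) (s : R) :
  continuous V1 s -> continuous V2 s -> continuous (fun r => lorentz (V1 r) (V2 r)) s.
Proof.
intros h1 h2; unfold lorentz.
apply continuous_comp with (f := fun r => 1 + (V1 r ^ 2 + V2 r ^ 2)).
- apply (continuous_plus (fun _ => 1) (fun r => V1 r ^ 2 + V2 r ^ 2)); [apply continuous_const|].
  apply (continuous_plus (fun r => V1 r ^ 2) (fun r => V2 r ^ 2)); simpl.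
  + apply (continuous_comp V1 (fun x => x * (x * 1))); [easy|].
    apply (ex_derive_continuous (fun x => x * (x * 1))); auto_derive; exact Logic.I.
  + apply (continuous_comp V2 (fun x => x * (x * 1))); [easy|].
    apply (ex_derive_continuous (fun x => x * (x * 1))); auto_derive; exact Logic.I.
- apply continuity_pt_filterlim, continuity_pt_sqrt; nra.
Qed.

(** The magnetic force is orthogonal to the velocity, hence drops out of the derivative of the
    energy [lorentz (V1 s) (V2 s)], which only sees the bounded electric field. *)
Lemma lorentz_growth (T C0 a b : R) (E1 E2 B : R -> R -> R) (Bext X V1 V2 : R -> R) :
  0 < C0 -> 0 <= a -> b <= T ->
  (forall s y, closed_interval 0 T s -> Omega y -> norm2 (E1 s y, E2 s y) <= C0) ->
  solves_on a b E1 E2 B Bext X V1 V2 ->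
  forall s t, a <= s <= b -> a <= t <= b ->
    lorentz (V1 s) (V2 s) <= lorentz (V1 t) (V2 t) + 2 * C0 * T.
Proof.
intros hC ha hb hE [hc hd] s t hs ht.
assert (h : Rabs (lorentz (V1 s) (V2 s) - lorentz (V1 t) (V2 t)) <= 2 * C0 * Rabs (s - t)).
{ apply (derive_bounded_increment (fun r => lorentz (V1 r) (V2 r))
    (fun r => (V1 r * E1 r (X r) + V2 r * E2 r (X r)) / lorentz (V1 r) (V2 r)) a b); auto.
  - lra.
  - intros r hr; destruct (hd r hr) as [_ [h1 h2]].
    assert (h := is_derive_lorentz V1 V2 r _ _ h1 h2).
    match type of h with is_derive _ _ ?l => replace l with
      ((V1 r * E1 r (X r) + V2 r * E2 r (X r)) / lorentz (V1 r) (V2 r)) in h; [exact h|] end.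
    rewrite hat1_eq, hat2_eq; field.
    assert (h3 := lorentz_ge_1 (V1 r) (V2 r)); lra.
  - intros r hr; apply continuous_lorentz; now apply hc.
  - intros r hr; set (w := lorentz (V1 r) (V2 r)).
    assert (hw : 1 <= w) by apply lorentz_ge_1.
    destruct (abs_le_lorentz (V1 r) (V2 r)) as [h1 h2]; fold w in h1, h2.
    destruct (abs_le_norm2 (E1 r (X r)) (E2 r (X r))) as [h3 h4].
    assert (h5 : norm2 (E1 r (X r), E2 r (X r)) <= C0)
      by (apply hE; [unfold closed_interval; lra|apply hc; lra]).
    unfold Rdiv; rewrite Rabs_mult, (Rabs_pos_eq (/ w))
      by (left; apply Rinv_0_lt_compat; lra).
    apply (Rmult_le_reg_r w); [lra|].
    rewrite Rmult_assoc, Rinv_l, Rmult_1_r by lra.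
    apply Rle_trans with (1 := Rabs_triang _ _); rewrite !Rabs_mult.
    assert (g1 := Rabs_pos (V1 r)); assert (g2 := Rabs_pos (V2 r)).
    assert (g3 := Rabs_pos (E1 r (X r))); assert (g4 := Rabs_pos (E2 r (X r))).
    assert (Rabs (V1 r) * Rabs (E1 r (X r)) <= w * C0) by (apply Rmult_le_compat; lra).
    assert (Rabs (V2 r) * Rabs (E2 r (X r)) <= w * C0) by (apply Rmult_le_compat; lra).
    lra. }
assert (h1 : Rabs (s - t) <= T) by (apply Rabs_le; lra).
assert (h2 := Rle_abs (lorentz (V1 s) (V2 s) - lorentz (V1 t) (V2 t))).
nra.
Qed.

Lemma vector_potential_bound (T C : R) (B : R -> R -> R) (s y : R) :
  C1_strip T B -> 0 <= C -> closed_interval 0 T s -> Omega y ->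
  (forall y, Omega y -> Rabs (B s y) <= C) ->
  Rabs (RInt (B s) (1 / 2) y) <= C.
Proof.
intros hB hC hs hy hb.
destruct (Rle_dec (1 / 2) y) as [h|h].
- apply Rle_trans with ((y - 1 / 2) * C).
  + apply abs_RInt_le_const; auto.
    * apply (ex_RInt_slice T); auto using Omega_half.
    * intros z hz; apply hb; unfold Omega in *; lra.
  + unfold Omega in hy; nra.
- rewrite <- opp_RInt_swap by (apply (ex_RInt_slice T); auto using Omega_half).
  change (Rabs (- RInt (B s) y (1 / 2)) <= C); rewrite Rabs_Ropp.
  apply Rle_trans with ((1 / 2 - y) * C).
  + apply abs_RInt_le_const; [lra| |].
    * apply (ex_RInt_slice T); auto using Omega_half.
    * intros z hz; apply hb; unfold Omega in *; lra.
  + unfold Omega in hy; nra.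
Qed.

(** The canonical momentum [V2 + A(s, X) + psi(X)], with [A] the vector potential of [B], has
    derivative [E2 s (1/2)]: every other term cancels.  It therefore varies by at most [C0 T].
    Since [V2] is controlled by the energy and [A] by [C0'], the variation of [psi(X)] along the
    path is controlled as well.  The identity is used strictly inside [a, b], where the
    fields have two-sided time derivatives, and the estimate is carried to the ends by continuity. *)
Lemma external_potential_bound (T C0 C0' a b : R) (E1 E2 B : R -> R -> R)
    (psi Bext X V1 V2 : R -> R) :
  C1_strip T E2 -> C1_strip T B ->
  (forall s y, closed_interval 0 T s -> Omega y ->
     is_derive_in (closed_interval 0 T) (fun s' => B s' y) s (- Derive (fun y' => E2 s y') y)) ->
  (forall y, Omega y -> is_derive psi y (Bext y)) ->
  0 < C0 -> 0 < C0' -> 0 <= a -> a < b -> b <= T ->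
  (forall s y, closed_interval 0 T s -> Omega y -> norm2 (E1 s y, E2 s y) <= C0) ->
  (forall s y, closed_interval 0 T s -> Omega y -> Rabs (B s y) <= C0') ->
  solves_on a b E1 E2 B Bext X V1 V2 ->
  forall s t, a <= s <= b -> a <= t <= b ->
    Rabs (psi (X s)) <= Rabs (psi (X t)) + C0 * T
      + 2 * (lorentz (V1 t) (V2 t) + 2 * C0 * T) + 2 * C0'.
Proof.
intros hE2 hB hF hpsi hC hC' ha hab hb hE hBb hsol s t hs ht.
destruct (hsol) as [hc hd].
set (W := lorentz (V1 t) (V2 t) + 2 * C0 * T).
set (canonical := fun r => V2 r + RInt (B r) (1 / 2) (X r) + psi (X r)).
assert (hin : forall r, a <= r <= b -> closed_interval 0 T r)
  by (unfold closed_interval; intros; lra).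
assert (dcan : forall r, a < r < b -> is_derive canonical r (E2 r (1 / 2))).
{ intros r hr; destruct (hd r hr) as [dX [_ dV]].
  assert (hX : Omega (X r)) by (apply hc; lra).
  assert (dA := is_derive_vector_potential T E2 B X r _ hE2 hB hF
                  (conj (Rle_lt_trans _ _ _ ha (proj1 hr)) (Rlt_le_trans _ _ _ (proj2 hr) hb)) hX dX).
  assert (dP := is_derive_comp psi X r _ _ (hpsi _ hX) dX).
  assert (h := is_derive_plus _ _ r _ _ (is_derive_plus _ _ r _ _ dV dA) dP).
  match type of h with is_derive _ _ ?l => replace l with (E2 r (1 / 2)) in h; [exact h|] end.
  unfold plus, scal, mult; simpl; unfold mult; simpl; ring. }
assert (key : forall s t, a < s < b -> a < t < b ->
  Rabs (psi (X s) - psi (X t)) <= C0 * T + 2 * W + 2 * C0').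
{ intros p q hp hq.
  assert (hcan : Rabs (canonical p - canonical q) <= C0 * Rabs (p - q)).
  { assert (hsub : forall r, Rmin p q <= r <= Rmax p q -> a < r < b).
    { unfold Rmin, Rmax; destruct (Rle_dec p q); intros; lra. }
    apply (derive_bounded_increment canonical (fun r => E2 r (1 / 2)) (Rmin p q) (Rmax p q)).
    - lra.
    - intros r hr; apply dcan, hsub; lra.
    - intros r hr; eapply is_derive_continuous; apply dcan, hsub; lra.
    - intros r hr; assert (hr' : a < r < b) by (apply hsub; lra).
      apply Rle_trans with (norm2 (E1 r (1 / 2), E2 r (1 / 2))).
      + apply abs_le_norm2.
      + apply hE; [apply hin; lra|apply Omega_half].
    - split; [apply Rmin_l|apply Rmax_l].
    - split; [apply Rmin_r|apply Rmax_r]. }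
  assert (hpq : Rabs (p - q) <= T) by (apply Rabs_le; lra).
  assert (hcan' : Rabs (canonical p - canonical q) <= C0 * T) by nra.
  assert (hV : forall r, a < r < b -> Rabs (V2 r) <= W).
  { intros r hr; apply Rle_trans with (lorentz (V1 r) (V2 r)); [apply abs_le_lorentz|].
    apply (lorentz_growth T C0 a b E1 E2 B Bext X); auto; lra. }
  assert (hA : forall r, a < r < b -> Rabs (RInt (B r) (1 / 2) (X r)) <= C0').
  { intros r hr; apply (vector_potential_bound T); auto; try lra.
    - apply hin; lra.
    - apply hc; lra.
    - intros y hy; apply hBb; auto; apply hin; lra. }
  assert (v1 := hV p hp); assert (v2 := hV q hq).
  assert (a1 := hA p hp); assert (a2 := hA q hq).
  replace (psi (X p) - psi (X q)) with
    ((canonical p - canonical q) - V2 p + V2 q - RInt (B p) (1 / 2) (X p)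
      + RInt (B q) (1 / 2) (X q)) by (unfold canonical; ring).
  apply Rabs_le; apply Rabs_le_between in hcan', v1, v2, a1, a2; lra. }
assert (h : Rabs (psi (X s) - psi (X t)) <= C0 * T + 2 * W + 2 * C0').
{ apply (oscillation_closure (fun r => psi (X r)) a b); auto.
  intros r hr; destruct (hc r hr) as [hX [cX _]].
  apply (continuous_comp X psi); [exact cX|].
  eapply is_derive_continuous; now apply hpsi. }
replace (psi (X s)) with (psi (X t) + (psi (X s) - psi (X t))) by ring.
apply Rle_trans with (1 := Rabs_triang _ _); lra.
Qed.

(** * Freezing the fields outside a compact set *)

(** By uniform continuity the value changes by at most one per step of size [delta / 2] away from
    the corner, and the rectangle is crossed in finitely many steps. *)
Lemma bounded_on_rectangle (f : R -> R -> R) (a b c d : R) :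
  a <= b -> c <= d ->
  (forall x y, a <= x <= b -> c <= y <= d -> continuity_2d_pt f x y) ->
  exists K, 0 <= K /\ forall x y, a <= x <= b -> c <= y <= d -> Rabs (f x y) <= K.
Proof.
intros hab hcd hf.
destruct (uniform_continuity_2d f a b c d hf (mkposreal 1 Rlt_0_1)) as [delta hd]; simpl in hd.
assert (dp := cond_pos delta).
assert (hn : forall n x y, a <= x <= b -> c <= y <= d ->
  x - a <= INR n * (delta / 2) -> y - c <= INR n * (delta / 2) ->
  Rabs (f x y - f a c) <= INR n).
{ induction n as [|n IH]; intros x y hx hy hxn hyn.
  - simpl in hxn, hyn; replace x with a by lra; replace y with c by lra.
    rewrite Rminus_diag, Rabs_R0; simpl; lra.
  - rewrite S_INR in *.
    assert (hn0 := pos_INR n).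
    set (x' := Rmax a (x - delta / 2)); set (y' := Rmax c (y - delta / 2)).
    assert (hx1 : a <= x' <= x /\ x - x' <= delta / 2 /\ x' - a <= INR n * (delta / 2)).
    { assert (0 <= INR n * (delta / 2)) by (apply Rmult_le_pos; lra).
      unfold x', Rmax; destruct (Rle_dec _ _); repeat split; lra. }
    assert (hy1 : c <= y' <= y /\ y - y' <= delta / 2 /\ y' - c <= INR n * (delta / 2)).
    { assert (0 <= INR n * (delta / 2)) by (apply Rmult_le_pos; lra).
      unfold y', Rmax; destruct (Rle_dec _ _); repeat split; lra. }
    assert (h1 : Rabs (f x' y' - f a c) <= INR n) by (apply IH; lra).
    assert (h2 : Rabs (f x y - f x' y') < 1)
      by (apply hd; try lra; rewrite Rabs_pos_eq; lra).
    replace (f x y - f a c) with ((f x y - f x' y') + (f x' y' - f a c)) by ring.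
    apply Rle_trans with (1 := Rabs_triang _ _); lra. }
destruct (nfloor_ex (Rmax (b - a) (d - c) / (delta / 2))) as [N [_ hN]].
{ apply Rdiv_le_0_compat; [|lra].
  apply Rle_trans with (2 := Rmax_l _ _); lra. }
exists (INR N + 1 + Rabs (f a c)); split.
{ assert (h1 := pos_INR N); assert (h2 := Rabs_pos (f a c)); lra. }
intros x y hx hy.
assert (h0 : Rmax (b - a) (d - c) <= INR (S N) * (delta / 2)).
{ rewrite S_INR; apply Rmult_lt_compat_r with (r := delta / 2) in hN; [|lra].
  unfold Rdiv at 1 in hN; rewrite Rmult_assoc, Rinv_l, Rmult_1_r in hN by lra; lra. }
assert (h1 := Rmax_l (b - a) (d - c)); assert (h2 := Rmax_r (b - a) (d - c)).
assert (h3 : Rabs (f x y - f a c) <= INR (S N)) by (apply hn; lra).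
rewrite S_INR in h3.
replace (f x y) with ((f x y - f a c) + f a c) by ring.
apply Rle_trans with (1 := Rabs_triang _ _); lra.
Qed.

(** The field frozen outside the compact set [0, T] x [d, 1 - d], hence defined everywhere. *)
Definition restrict (T d : R) (f : R -> R -> R) (s y : R) : R :=
  f (clamp 0 T s) (clamp d (1 - d) y).

(** One constant serves both as a bound and as a Lipschitz constant in space; this is what the
    freezing of a [C1] field provides. *)
Definition tame (K : R) (g : R -> R -> R) : Prop :=
  (forall s y, Rabs (g s y) <= K) /\
  (forall s y z, Rabs (g s y - g s z) <= K * Rabs (y - z)) /\
  (forall q : R -> R, (forall s, continuous q s) -> forall s, continuous (fun r => g r (q r)) s).

Lemma clamp_Omega (d y : R) : 0 < d < 1 / 2 -> Omega (clamp d (1 - d) y).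
Proof.
intros hd; assert (h : closed_interval d (1 - d) (clamp d (1 - d) y)) by (apply clamp_in; lra).
unfold closed_interval in h; unfold Omega; lra.
Qed.

Lemma restrict_continuous_bounded (T d : R) (f : R -> R -> R) :
  0 <= T -> 0 < d < 1 / 2 ->
  continuous_on (strip T) (fun p => f (fst p) (snd p)) ->
  (forall q p : R -> R, (forall s, continuous q s) -> (forall s, continuous p s) ->
     forall s, continuous (fun r => restrict T d f (p r) (q r)) s) /\
  exists K, 0 <= K /\ forall s y, Rabs (restrict T d f s y) <= K.
Proof.
intros hT hd hf.
assert (hmem : forall s y, strip T (clamp 0 T s, clamp d (1 - d) y)).
{ intros s y; split; [now apply clamp_in|now apply clamp_Omega]. }
split.
- intros q p hq hp s.
  apply (continuous_on_comp (strip T) (fun z => f (fst z) (snd z))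
    (fun r => (clamp 0 T (p r), clamp d (1 - d) (q r)))); auto.
  apply (continuous_comp_2 (fun r => clamp 0 T (p r)) (fun r => clamp d (1 - d) (q r)) pair).
  + apply (continuous_comp p (clamp 0 T)); auto using clamp_continuous.
  + apply (continuous_comp q (clamp d (1 - d))); auto using clamp_continuous.
  + apply continuous_ext with (fun z => z); [now intros []|apply continuous_id].
- destruct (bounded_on_rectangle (restrict T d f) 0 T d (1 - d)) as [K [hK h]]; try lra.
  + intros x y _ _; apply continuity_2d_pt_filterlim.
    apply (continuous_on_comp (strip T) (fun z => f (fst z) (snd z))
      (fun z : R * R => (clamp 0 T (fst z), clamp d (1 - d) (snd z))) (x, y)); auto.
    apply (continuous_comp_2 (fun z : R * R => clamp 0 T (fst z))
      (fun z => clamp d (1 - d) (snd z)) pair).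
    * apply (continuous_comp fst (clamp 0 T)); [apply continuous_fst|apply clamp_continuous].
    * apply (continuous_comp snd (clamp d (1 - d))); [apply continuous_snd|apply clamp_continuous].
    * apply continuous_ext with (fun z => z); [now intros []|apply continuous_id].
  + exists K; split; [easy|]; intros s y.
    assert (h1 := clamp_in 0 T s hT).
    assert (h2 : closed_interval d (1 - d) (clamp d (1 - d) y)) by (apply clamp_in; lra).
    replace (restrict T d f s y) with (restrict T d f (clamp 0 T s) (clamp d (1 - d) y)).
    * now apply h.
    * unfold restrict; now rewrite (clamp_id 0 T), (clamp_id d (1 - d)).
Qed.

(** The space derivative is continuous, hence bounded on the compact set where the frozen field
    is evaluated, and clamping does not increase distances. *)
Lemma restrict_tame (T d : R) (f : R -> R -> R) :
  0 <= T -> 0 < d < 1 / 2 -> C1_strip T f ->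
  exists K, 0 <= K /\ tame K (restrict T d f).
Proof.
intros hT hd [fs [fy [hder [hf [_ hfy]]]]].
destruct (restrict_continuous_bounded T d f hT hd hf) as [hcont [M [hM hb]]].
destruct (restrict_continuous_bounded T d fy hT hd hfy) as [_ [L [hL hl]]].
exists (Rmax M L); split; [apply Rle_trans with (1 := hM), Rmax_l|].
repeat split.
- intros s y; apply Rle_trans with (1 := hb s y), Rmax_l.
- intros s y z.
  assert (hs := clamp_in 0 T s hT).
  assert (hy : closed_interval d (1 - d) (clamp d (1 - d) y)) by (apply clamp_in; lra).
  assert (hz : closed_interval d (1 - d) (clamp d (1 - d) z)) by (apply clamp_in; lra).
  assert (hO : forall r, d <= r <= 1 - d -> Omega r) by (unfold Omega; intros; lra).
  unfold restrict.
  apply Rle_trans with (L * Rabs (clamp d (1 - d) y - clamp d (1 - d) z)).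
  + apply (derive_bounded_increment (f (clamp 0 T s)) (fy (clamp 0 T s)) d (1 - d)); auto.
    * intros r hr; apply hder; auto; apply hO; lra.
    * intros r hr; eapply is_derive_continuous, hder; auto.
    * intros r hr; assert (h := hl s r); unfold restrict in h.
      rewrite (clamp_id d (1 - d) r) in h by (unfold closed_interval; lra); exact h.
  + apply Rmult_le_compat; try apply Rabs_pos; auto using Rmax_r, clamp_lipschitz.
- intros q hq s; apply (hcont q (fun r => r)); auto.
  intros r; apply continuous_id.
Qed.

Lemma tame_plus (K1 K2 : R) (f g : R -> R -> R) :
  tame K1 f -> tame K2 g -> tame (K1 + K2) (fun s y => f s y + g s y).
Proof.
intros [b1 [l1 c1]] [b2 [l2 c2]]; repeat split.
- intros s y; apply Rle_trans with (1 := Rabs_triang _ _), Rplus_le_compat; auto.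
- intros s y z.
  replace (f s y + g s y - (f s z + g s z)) with ((f s y - f s z) + (g s y - g s z)) by ring.
  apply Rle_trans with (1 := Rabs_triang _ _); rewrite Rmult_plus_distr_r.
  apply Rplus_le_compat; auto.
- intros q hq s; apply (continuous_plus (fun r => f r (q r)) (fun r => g r (q r))); auto.
Qed.

Lemma tame_weaken (K K' : R) (f : R -> R -> R) :
  K <= K' -> tame K f -> tame K' f.
Proof.
intros h [b [l c]]; repeat split; auto.
- intros s y; apply Rle_trans with (1 := b s y); easy.
- intros s y z; apply Rle_trans with (1 := l s y z).
  apply Rmult_le_compat_r; [apply Rabs_pos|easy].
Qed.

(** * Regularity of the relativistic velocity and of the vector field *)

(** The difference of the squares factors through [w + w'], which dominates [a + a'] and
    [b + b']. *)
Lemma lorentz_lipschitz (a b a' b' D : R) :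
  Rabs (a - a') <= D -> Rabs (b - b') <= D -> Rabs (lorentz a b - lorentz a' b') <= 2 * D.
Proof.
intros h1 h2.
set (w := lorentz a b); set (w' := lorentz a' b').
assert (e := lorentz_sqr a b); fold w in e.
assert (e' := lorentz_sqr a' b'); fold w' in e'.
assert (hw : 1 <= w) by apply lorentz_ge_1.
assert (hw' : 1 <= w') by apply lorentz_ge_1.
destruct (abs_le_lorentz a b) as [ha hb]; fold w in ha, hb.
destruct (abs_le_lorentz a' b') as [ha' hb']; fold w' in ha', hb'.
apply (Rmult_le_reg_r (w + w')); [lra|].
replace (Rabs (w - w') * (w + w')) with (Rabs ((a - a') * (a + a') + (b - b') * (b + b'))).
- apply Rle_trans with (1 := Rabs_triang _ _); rewrite !Rabs_mult.
  assert (s1 := Rabs_triang a a'); assert (s2 := Rabs_triang b b').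
  assert (Rabs (a - a') * Rabs (a + a') <= D * (w + w'))
    by (apply Rmult_le_compat; try apply Rabs_pos; lra).
  assert (Rabs (b - b') * Rabs (b + b') <= D * (w + w'))
    by (apply Rmult_le_compat; try apply Rabs_pos; lra).
  lra.
- rewrite <- (Rabs_pos_eq (w + w')) at 1 by lra; rewrite <- Rabs_mult; f_equal; nra.
Qed.

Lemma quotient_lipschitz (p p' w w' D : R) :
  Rabs (p - p') <= D -> Rabs p' <= w' -> 1 <= w -> 1 <= w' -> Rabs (w - w') <= 2 * D ->
  Rabs (p / w - p' / w') <= 3 * D.
Proof.
intros hp hp' hw hw' hd.
replace (p / w - p' / w') with (((p - p') - p' / w' * (w - w')) / w) by (field; lra).
assert (hq : Rabs (p' / w') <= 1).
{ unfold Rdiv; rewrite Rabs_mult, (Rabs_pos_eq (/ w')) by (left; apply Rinv_0_lt_compat; lra).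
  apply (Rmult_le_reg_r w'); [lra|]; rewrite Rmult_assoc, Rinv_l; lra. }
unfold Rdiv at 1; rewrite Rabs_mult, (Rabs_pos_eq (/ w)) by (left; apply Rinv_0_lt_compat; lra).
assert (hn : Rabs (p - p' - p' / w' * (w - w')) <= 3 * D).
{ apply Rle_trans with (1 := Rabs_triang _ _); rewrite Rabs_Ropp, Rabs_mult.
  assert (h1 := Rabs_pos (w - w')); assert (h2 := Rabs_pos (p' / w')); nra. }
assert (hi : 0 < / w <= 1).
{ split; [apply Rinv_0_lt_compat; lra|].
  rewrite <- Rinv_1; apply Rinv_le_contravar; lra. }
assert (h0 := Rabs_pos (p - p' - p' / w' * (w - w'))).
nra.
Qed.

Lemma hat_lipschitz (a b a' b' D : R) :
  Rabs (a - a') <= D -> Rabs (b - b') <= D ->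
  Rabs (hat1 (a, b) - hat1 (a', b')) <= 3 * D /\ Rabs (hat2 (a, b) - hat2 (a', b')) <= 3 * D.
Proof.
intros h1 h2; rewrite !hat1_eq, !hat2_eq.
split; apply quotient_lipschitz; auto using lorentz_ge_1, lorentz_lipschitz; apply abs_le_lorentz.
Qed.

Lemma hat_bounded (a b : R) : Rabs (hat1 (a, b)) <= 1 /\ Rabs (hat2 (a, b)) <= 1.
Proof.
assert (h := lorentz_ge_1 a b).
rewrite hat1_eq, hat2_eq; unfold Rdiv; rewrite !Rabs_mult.
rewrite (Rabs_pos_eq (/ lorentz a b)) by (left; apply Rinv_0_lt_compat; lra).
split; apply (Rmult_le_reg_r (lorentz a b)); try lra;
rewrite Rmult_assoc, Rinv_l, Rmult_1_r, Rmult_1_l by lra; apply abs_le_lorentz.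
Qed.

Lemma continuous_hat (V1 V2 : R -> R) (s : R) :
  continuous V1 s -> continuous V2 s ->
  continuous (fun r => hat1 (V1 r, V2 r)) s /\ continuous (fun r => hat2 (V1 r, V2 r)) s.
Proof.
intros h1 h2.
assert (h := lorentz_ge_1 (V1 s) (V2 s)).
assert (hc : continuous (fun r => / lorentz (V1 r) (V2 r)) s).
{ apply (continuous_comp (fun r => lorentz (V1 r) (V2 r)) Rinv).
  - now apply continuous_lorentz.
  - apply continuous_Rinv; lra. }
split.
- apply continuous_ext with (fun r => mult (V1 r) (/ lorentz (V1 r) (V2 r))).
  + intros r; rewrite hat1_eq; reflexivity.
  + now apply (continuous_mult V1 (fun r => / lorentz (V1 r) (V2 r))).
- apply continuous_ext with (fun r => mult (V2 r) (/ lorentz (V1 r) (V2 r))).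
  + intros r; rewrite hat2_eq; reflexivity.
  + now apply (continuous_mult V2 (fun r => / lorentz (V1 r) (V2 r))).
Qed.

Inductive phase_coord : Set := Position | Velocity1 | Velocity2.

Definition lorentz_field (e1 e2 b : R -> R -> R) (s : R) (x : phase_coord -> R) (i : phase_coord) : R :=
  match i with
  | Position => hat1 (x Velocity1, x Velocity2)
  | Velocity1 => e1 s (x Position) + hat2 (x Velocity1, x Velocity2) * b s (x Position)
  | Velocity2 => e2 s (x Position) - hat1 (x Velocity1, x Velocity2) * b s (x Position)
  end.

Lemma product_lipschitz (K D h h' b b' : R) :
  Rabs h <= 1 -> Rabs b' <= K -> Rabs (h - h') <= 3 * D -> Rabs (b - b') <= K * D ->
  Rabs (h * b - h' * b') <= 4 * K * D.
Proof.
intros h1 h2 h3 h4.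
replace (h * b - h' * b') with (h * (b - b') + (h - h') * b') by ring.
apply Rle_trans with (1 := Rabs_triang _ _); rewrite !Rabs_mult.
assert (g1 := Rabs_pos h); assert (g2 := Rabs_pos b').
assert (g3 := Rabs_pos (h - h')); assert (g4 := Rabs_pos (b - b')).
nra.
Qed.

Lemma lorentz_field_bounded_lipschitz (K : R) (e1 e2 b : R -> R -> R) :
  0 <= K -> tame K e1 -> tame K e2 -> tame K b ->
  bounded_lipschitz_field (3 + 5 * K) (1 + 2 * K) (lorentz_field e1 e2 b).
Proof.
intros hK [m1 [l1 c1]] [m2 [l2 c2]] [m3 [l3 c3]]; repeat split.
- intros s x i.
  destruct (hat_bounded (x Velocity1) (x Velocity2)) as [h1 h2].
  assert (g1 := m1 s (x Position)); assert (g2 := m2 s (x Position)).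
  assert (g3 := m3 s (x Position)).
  assert (p1 := Rabs_pos (hat1 (x Velocity1, x Velocity2))).
  assert (p2 := Rabs_pos (hat2 (x Velocity1, x Velocity2))).
  assert (p3 := Rabs_pos (b s (x Position))).
  destruct i; unfold lorentz_field.
  + lra.
  + apply Rle_trans with (1 := Rabs_triang _ _); rewrite Rabs_mult; nra.
  + apply Rle_trans with (1 := Rabs_triang _ _); rewrite Rabs_Ropp, Rabs_mult; nra.
- intros s x y D hxy i.
  assert (hD : 0 <= D) by (apply Rle_trans with (2 := hxy i), Rabs_pos).
  destruct (hat_lipschitz _ _ _ _ D (hxy Velocity1) (hxy Velocity2)) as [h1 h2].
  destruct (hat_bounded (x Velocity1) (x Velocity2)) as [b1 b2].
  assert (hp := hxy Position).
  assert (mono : forall z, z <= K * Rabs (x Position - y Position) -> z <= K * D)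
    by (intros z hz; apply Rle_trans with (1 := hz), Rmult_le_compat_l; lra).
  assert (g1 := mono _ (l1 s (x Position) (y Position))).
  assert (g2 := mono _ (l2 s (x Position) (y Position))).
  assert (g3 := mono _ (l3 s (x Position) (y Position))).
  assert (k3 := m3 s (y Position)).
  destruct i; unfold lorentz_field.
  + assert (0 <= K * D) by (apply Rmult_le_pos; lra); lra.
  + assert (g := product_lipschitz K D _ _ _ _ b2 k3 h2 g3).
    replace (e1 s (x Position) + hat2 (x Velocity1, x Velocity2) * b s (x Position) -
      (e1 s (y Position) + hat2 (y Velocity1, y Velocity2) * b s (y Position)))
      with ((e1 s (x Position) - e1 s (y Position))
        + (hat2 (x Velocity1, x Velocity2) * b s (x Position)
          - hat2 (y Velocity1, y Velocity2) * b s (y Position))) by ring.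
    apply Rle_trans with (1 := Rabs_triang _ _); lra.
  + assert (g := product_lipschitz K D _ _ _ _ b1 k3 h1 g3).
    replace (e2 s (x Position) - hat1 (x Velocity1, x Velocity2) * b s (x Position) -
      (e2 s (y Position) - hat1 (y Velocity1, y Velocity2) * b s (y Position)))
      with ((e2 s (x Position) - e2 s (y Position))
        - (hat1 (x Velocity1, x Velocity2) * b s (x Position)
          - hat1 (y Velocity1, y Velocity2) * b s (y Position))) by ring.
    apply Rle_trans with (1 := Rabs_triang _ _); rewrite Rabs_Ropp; lra.
- intros u hu i s.
  destruct (continuous_hat _ _ s (hu Velocity1 s) (hu Velocity2 s)) as [h1 h2].
  assert (h3 := c3 _ (hu Position) s).
  destruct i; unfold lorentz_field.
  + exact h1.
  + apply (continuous_plus (fun r => e1 r (u Position r))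
      (fun r => mult (hat2 (u Velocity1 r, u Velocity2 r)) (b r (u Position r)))).
    * apply c1, hu.
    * now apply (continuous_mult (fun r => hat2 (u Velocity1 r, u Velocity2 r))
        (fun r => b r (u Position r))).
  + apply (continuous_minus (fun r => e2 r (u Position r))
      (fun r => mult (hat1 (u Velocity1 r, u Velocity2 r)) (b r (u Position r)))).
    * apply c2, hu.
    * now apply (continuous_mult (fun r => hat1 (u Velocity1 r, u Velocity2 r))
        (fun r => b r (u Position r))).
Qed.

(** * Continuation and the characteristic flow *)

Lemma is_derive_external (psi Bext : R -> R) :
  Cn_open 2 Omega psi -> (forall y, Omega y -> Bext y = Derive psi y) ->
  forall y, Omega y -> is_derive psi y (Bext y).
Proof.
intros h hB y hy; rewrite hB by easy.
apply Derive_correct, (h 1%nat y); auto.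
Qed.

Lemma external_field_C1_strip (T : R) (psi Bext : R -> R) :
  Cn_open 2 Omega psi -> (forall y, Omega y -> Bext y = Derive psi y) ->
  C1_strip T (fun _ y => Bext y).
Proof.
intros h hB.
assert (hd : forall y, Omega y -> is_derive Bext y (Derive_n psi 2 y)).
{ intros y hy; apply is_derive_ext_loc with (Derive_n psi 1).
  - generalize (locally_open_interval 0 1 y hy); apply filter_imp; intros z hz.
    symmetry; now apply hB.
  - apply Derive_correct, (h 2%nat y); auto. }
assert (hsnd : forall (g : R -> R), (forall y, Omega y -> continuous g y) ->
  continuous_on (strip T) (fun p => g (snd p))).
{ intros g hg; apply continuous_on_forall; intros [s y] [_ hy].
  apply (continuous_comp snd g); [apply continuous_snd|now apply hg]. }
exists (fun _ _ => 0), (fun _ y => Derive_n psi 2 y); split; [|split; [|split]].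
- intros s y hs hy; split; [|now apply hd].
  apply is_derive_is_derive_in; [easy|].
  apply (is_derive_const (Bext y)).
- apply hsnd; intros y hy; eapply is_derive_continuous; now apply hd.
- apply continuous_on_forall; intros; apply continuous_const.
- apply hsnd; intros y hy; apply (h 2%nat y); auto.
Qed.

Lemma continuous_positive_near (h : R -> R) (x : R) :
  continuous h x -> 0 < h x -> exists e : posreal, forall y, Rabs (y - x) < e -> 0 < h y.
Proof.
intros hc hx; destruct (hc (fun z => 0 < z) (open_gt 0 _ hx)) as [e he].
exists e; intros y hy; now apply he.
Qed.

(** Continuous induction: let [m] be the supremum of the times up to which [h] is positive.
    Then [h] is nonnegative on [0, m], so the hypothesis gives [h m > 0], and continuity would
    push the supremum further unless [m = b]. *)
Lemma positivity_bootstrap (h : R -> R) (b : R) :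
  0 <= b -> (forall r, continuous h r) -> 0 < h 0 ->
  (forall q, 0 <= q <= b -> (forall r, 0 <= r <= q -> 0 <= h r) -> 0 < h q) ->
  forall q, 0 <= q <= b -> 0 < h q.
Proof.
intros hb hc h0 hstep.
set (good := fun q => 0 <= q <= b /\ forall r, 0 <= r <= q -> 0 < h r).
assert (good0 : good 0).
{ split; [lra|]; intros r hr; replace r with 0 by lra; easy. }
destruct (completeness good) as [m [hub hlub]].
{ exists b; intros q [hq _]; lra. }
{ now exists 0. }
assert (hm0 : 0 <= m) by now apply hub.
assert (hmb : m <= b) by (apply hlub; intros q [hq _]; lra).
assert (hbelow : forall r, 0 <= r < m -> 0 < h r).
{ intros r hr; apply Rnot_le_lt; intros hle.
  assert (m <= r); [|lra].
  apply hlub; intros q [_ hq]; apply Rnot_lt_le; intros hlt.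
  assert (0 < h r) by (apply hq; lra); lra. }
assert (hm : 0 < h m).
{ apply hstep; [lra|]; intros r hr.
  destruct (Rlt_dec r m) as [hlt|hge]; [left; apply hbelow; lra|].
  replace r with m by lra; apply Rnot_lt_le; intros hneg.
  destruct (continuous_positive_near (fun z => - h z) m) as [e he]; [|lra|].
  { apply (continuous_opp h), hc. }
  assert (e0 := cond_pos e).
  destruct (Req_dec m 0) as [->|hne]; [lra|].
  set (r' := Rmax 0 (m - e / 2)).
  assert (hr' : 0 <= r' < m /\ m - r' < e) by (unfold r', Rmax; destruct (Rle_dec _ _); lra).
  assert (h1 := hbelow r' (proj1 hr')).
  assert (h2 : 0 < - h r') by (apply he; rewrite Rabs_left; lra).
  lra. }
destruct (continuous_positive_near h m (hc m) hm) as [e he].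
assert (e0 := cond_pos e).
assert (hall : forall r, 0 <= r < m + e -> 0 < h r).
{ intros r hr; destruct (Rlt_dec r m); [apply hbelow; lra|].
  apply he; rewrite Rabs_pos_eq; lra. }
assert (hmeq : m = b).
{ apply Rle_antisym; [easy|]; apply Rnot_lt_le; intros hlt.
  set (q := Rmin b (m + e / 2)).
  assert (hq : m < q <= b /\ q < m + e) by (unfold q, Rmin; destruct (Rle_dec _ _); lra).
  assert (q <= m); [|lra].
  apply hub; split; [lra|]; intros r hr; apply hall; lra. }
intros q hq; apply hall; lra.
Qed.

(** A two-sided form of [positivity_bootstrap], applied to [(f - lo) (hi - f)] followed forwards
    and backwards from [t]; for [lo < hi] the sign of this product tells whether [f] lies
    between the barriers. *)
Lemma interval_bootstrap (f : R -> R) (a b t lo hi : R) :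
  closed_interval a b t -> (forall s, continuous f s) -> lo < f t < hi ->
  (forall p q, a <= p -> q <= b -> p < q -> p <= t <= q ->
     (forall r, p <= r <= q -> lo <= f r <= hi) -> forall r, p <= r <= q -> lo < f r < hi) ->
  forall s, a <= s <= b -> lo < f s < hi.
Proof.
intros [hat htb] hc hft hstep.
set (g := fun s => (f s - lo) * (hi - f s)).
assert (hg : forall s, continuous g s).
{ intros s; apply (continuous_mult (fun s => f s - lo) (fun s => hi - f s)).
  - apply (continuous_minus f (fun _ => lo)); [apply hc|apply continuous_const].
  - apply (continuous_minus (fun _ => hi) f); [apply continuous_const|apply hc]. }
assert (gpos : forall s, 0 < g s -> lo < f s < hi) by (unfold g; intros; nra).
assert (gnn : forall s, 0 <= g s -> lo <= f s <= hi) by (unfold g; intros; nra).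
assert (posg : forall s, lo < f s < hi -> 0 < g s)
  by (unfold g; intros; apply Rmult_lt_0_compat; lra).
assert (dir : forall sigma c, sigma = 1 \/ sigma = -1 -> 0 <= c -> a <= t + sigma * c <= b ->
  0 < g (t + sigma * c)).
{ intros sigma c hsig hc0 hcb.
  apply (positivity_bootstrap (fun r => g (t + sigma * r)) c); auto; [| | |lra].
  - intros r; apply (continuous_comp (fun r => t + sigma * r) g); [|apply hg].
    apply (is_derive_continuous _ _ sigma); auto_derive; [exact Logic.I|ring].
  - rewrite Rmult_0_r, Rplus_0_r; auto.
  - intros q hq hle.
    destruct (Req_dec q 0) as [->|hq0]; [rewrite Rmult_0_r, Rplus_0_r; auto|].
    apply posg; destruct hsig as [-> | ->].
    + apply (hstep t (t + 1 * q)); try lra.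
      intros r hr; apply gnn; replace r with (t + 1 * (r - t)) by ring; apply hle; lra.
    + apply (hstep (t + -1 * q) t); try lra.
      intros r hr; apply gnn; replace r with (t + -1 * (t - r)) by ring; apply hle; lra. }
intros s hs; apply gpos; destruct (Rle_dec t s).
- replace s with (t + 1 * (s - t)) by ring; apply dir; auto; lra.
- replace s with (t + -1 * (t - s)) by ring; apply dir; auto; lra.
Qed.

Definition phase_path (X V1 V2 : R -> R) (i : phase_coord) : R -> R :=
  match i with Position => X | Velocity1 => V1 | Velocity2 => V2 end.

(** Coincides with the characteristic vector field as long as the position is in [d, 1 - d],
    but is globally bounded and Lipschitz. *)
Definition confined_field (T d : R) (E1 E2 B : R -> R -> R) (Bext : R -> R) :
    R -> (phase_coord -> R) -> phase_coord -> R :=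
  lorentz_field (restrict T d E1) (restrict T d E2)
    (fun s y => restrict T d B s y + restrict T d (fun _ => Bext) s y).

Lemma confined_field_spec (T d : R) (E1 E2 B : R -> R -> R) (Bext X V1 V2 : R -> R) (s : R) :
  closed_interval 0 T s -> d <= X s <= 1 - d ->
  let F := confined_field T d E1 E2 B Bext s (fun j => phase_path X V1 V2 j s) in
  F Position = hat1 (V1 s, V2 s) /\
  F Velocity1 = E1 s (X s) + hat2 (V1 s, V2 s) * (B s (X s) + Bext (X s)) /\
  F Velocity2 = E2 s (X s) - hat1 (V1 s, V2 s) * (B s (X s) + Bext (X s)).
Proof.
intros hs hX; unfold confined_field, lorentz_field, restrict; simpl.
rewrite (clamp_id 0 T s hs), (clamp_id d (1 - d) (X s)) by exact hX; auto.
Qed.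

Lemma confined_field_regular (T d : R) (E1 E2 B : R -> R -> R) (Bext : R -> R) :
  0 <= T -> 0 < d < 1 / 2 ->
  C1_strip T E1 -> C1_strip T E2 -> C1_strip T B -> C1_strip T (fun _ y => Bext y) ->
  exists L M, 0 < L /\ bounded_lipschitz_field L M (confined_field T d E1 E2 B Bext).
Proof.
intros hT hd h1 h2 h3 h4.
destruct (restrict_tame T d E1 hT hd h1) as [K1 [p1 t1]].
destruct (restrict_tame T d E2 hT hd h2) as [K2 [p2 t2]].
destruct (restrict_tame T d B hT hd h3) as [K3 [p3 t3]].
destruct (restrict_tame T d _ hT hd h4) as [K4 [p4 t4]].
set (K := K1 + K2 + (K3 + K4)).
exists (3 + 5 * K), (1 + 2 * K); split; [unfold K; lra|].
apply lorentz_field_bounded_lipschitz.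
- unfold K; lra.
- apply (tame_weaken K1); [unfold K; lra|easy].
- apply (tame_weaken K2); [unfold K; lra|easy].
- apply (tame_weaken (K3 + K4)); [unfold K; lra|now apply tame_plus].
Qed.

(** Clamping time does not change the path on [0, T] and makes it continuous on the line. *)
Lemma characteristic_solves_on (T : R) (E1 E2 B : R -> R -> R) (Bext : R -> R)
    (t x : R) (v : R * R) (X V1 V2 : R -> R) :
  0 <= T -> is_characteristic T E1 E2 B Bext t x v X V1 V2 ->
  solves_on 0 T E1 E2 B Bext (fun s => X (clamp 0 T s))
    (fun s => V1 (clamp 0 T s)) (fun s => V2 (clamp 0 T s)).
Proof.
intros hT [[hcX [hc1 hc2]] [hO [hder _]]]; split.
- intros s _; split; [now apply hO, clamp_in|].
  destruct hcX as [? [_ [cX _]]], hc1 as [? [_ [c1 _]]], hc2 as [? [_ [c2 _]]].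
  repeat split; now apply continuous_clamped.
- intros s hs; assert (hcl : closed_interval 0 T s) by (unfold closed_interval; lra).
  rewrite (clamp_id 0 T s hcl).
  destruct (hder s hcl) as [dX [d1 d2]].
  split; [|split]; apply is_derive_clamped; auto; now apply (is_derive_in_interior 0 T).
Qed.

Lemma C1_on_of_derive (D : R -> Prop) (f f' : R -> R) :
  (forall s, is_derive f s (f' s)) -> (forall s, continuous f' s) -> C1_on D f.
Proof.
intros hd hc; exists f'; split; [|split].
- intros s hs; now apply is_derive_is_derive_in.
- apply continuous_on_forall; intros s _; eapply is_derive_continuous, hd.
- apply continuous_on_forall; auto.
Qed.

Theorem corollary3p3
  (T : R) (hT : 0 < T)
  (psi_ext Bext : R -> R) (gamma c0 : R)
  (hgamma : 0 < gamma) (hc0 : 0 < c0)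
  (hpsi : Cn_open 2 Omega psi_ext)
  (hBext : forall x, Omega x -> Bext x = Derive psi_ext x)
  (hconf : forall x, Omega x ->
     Rabs (psi_ext x) >=
       c0 / Rpower (dist_set x (boundary Omega)) gamma - 1 / c0)
  (E1 E2 B : R -> R -> R)
  (hE1 : C1_strip T E1) (hE2 : C1_strip T E2) (hB : C1_strip T B)
  (hFaraday : forall s y, closed_interval 0 T s -> Omega y ->
     is_derive_in (closed_interval 0 T) (fun s' => B s' y) s
       (- Derive (fun y' => E2 s y') y))
  (C0 C0' : R) (hC0 : 0 < C0) (hC0' : 0 < C0')
  (hEbound : forall s y, closed_interval 0 T s -> Omega y ->
     norm2 (E1 s y, E2 s y) <= C0)
  (hBbound : forall s y, closed_interval 0 T s -> Omega y ->
     Rabs (B s y) <= C0')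
  (t x : R) (v : R * R) (ht : 0 < t <= T) (hx : Omega x) :
  exists X V1 V2 : R -> R,
    is_characteristic T E1 E2 B Bext t x v X V1 V2 /\
    (forall X' V1' V2' : R -> R,
       is_characteristic T E1 E2 B Bext t x v X' V1' V2' ->
       forall s, closed_interval 0 T s ->
         X' s = X s /\ V1' s = V1 s /\ V2' s = V2 s).
Proof.
destruct v as [v1 v2].
set (K := Rabs (psi_ext x) + C0 * T + 2 * (lorentz v1 v2 + 2 * C0 * T) + 2 * C0').
assert (hCT : 0 < C0 * T) by (apply Rmult_lt_0_compat; lra).
assert (hKx : Rabs (psi_ext x) <= K) by (unfold K; assert (h := lorentz_ge_1 v1 v2); lra).
destruct (potential_barrier psi_ext gamma c0 K) as [rho [hrho hbar]]; auto.
{ apply Rle_trans with (2 := hKx), Rabs_pos. }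
assert (hxrho := hbar x hx hKx).
(* The a priori estimate; it applies to any solution through [(x, v)] on any interval around [t]. *)
assert (trap : forall a b X V1 V2, 0 <= a -> a < b -> b <= T -> a <= t <= b ->
  solves_on a b E1 E2 B Bext X V1 V2 -> X t = x -> V1 t = v1 -> V2 t = v2 ->
  forall s, a <= s <= b -> rho <= X s <= 1 - rho).
{ intros a b X V1 V2 ha hab hb hat hsol eX e1 e2 s hs; apply hbar; [now apply hsol|].
  assert (h := external_potential_bound T C0 C0' a b E1 E2 B psi_ext Bext X V1 V2
    hE2 hB hFaraday (is_derive_external psi_ext Bext hpsi hBext) hC0 hC0' ha hab hb
    hEbound hBbound hsol s t hs hat).
  rewrite eX, e1, e2 in h; exact h. }
(* Any margin strictly below [rho] works: the a priori bound then keeps paths away from [d]. *)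
set (d := rho / 2).
assert (hd : 0 < d < 1 / 2) by (unfold d; lra).
destruct (confined_field_regular T d E1 E2 B Bext) as [L [M [hL hF]]]; auto; [lra| |].
{ now apply external_field_C1_strip with psi_ext. }
set (F := confined_field T d E1 E2 B Bext) in *.
destruct (picard_existence L M F t
  (fun i => match i with Position => x | Velocity1 => v1 | Velocity2 => v2 end) hL hF)
  as [u [u0 du]].
set (X := u Position); set (V1 := u Velocity1); set (V2 := u Velocity2).
assert (cu : forall i s, continuous (u i) s)
  by (intros i s; eapply is_derive_continuous, du).
assert (hFu : forall s i, F s (fun j => u j s) i = F s (fun j => phase_path X V1 V2 j s) i)
  by (intros s []; reflexivity).
assert (eqs : forall s, closed_interval 0 T s -> d <= X s <= 1 - d ->
  is_derive X s (hat1 (V1 s, V2 s)) /\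
  is_derive V1 s (E1 s (X s) + hat2 (V1 s, V2 s) * (B s (X s) + Bext (X s))) /\
  is_derive V2 s (E2 s (X s) - hat1 (V1 s, V2 s) * (B s (X s) + Bext (X s)))).
{ intros s hs hX.
  destruct (confined_field_spec T d E1 E2 B Bext X V1 V2 s hs hX) as [q1 [q2 q3]].
  fold F in q1, q2, q3.
  assert (p1 := du Position s); assert (p2 := du Velocity1 s); assert (p3 := du Velocity2 s).
  rewrite hFu in p1, p2, p3; rewrite q1 in p1; rewrite q2 in p2; rewrite q3 in p3; auto. }
(* As long as the path stays in [d, 1 - d] it solves the original system, so it is even
   confined to [rho, 1 - rho] and cannot reach the edge of the region of validity. *)
assert (inside : forall s, 0 <= s <= T -> d < X s < 1 - d).
{ apply (interval_bootstrap X 0 T t).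
  - unfold closed_interval; lra.
  - apply cu.
  - unfold X; rewrite u0; unfold d; lra.
  - intros p q hp hq hpq htpq hr r hrpq.
    assert (rho <= X r <= 1 - rho); [|unfold d; lra].
    apply (trap p q X V1 V2); auto; try apply u0.
    split.
    + intros s hs; split; [destruct (hr s hs); unfold Omega; lra|].
      split; [|split]; apply cu.
    + intros s hs; apply eqs; [unfold closed_interval; lra|apply hr; lra]. }
exists X, V1, V2; split.
- split; [|split; [|split]].
  + split; [|split]; apply C1_on_of_derive with (1 := du _); apply hF; exact cu.
  + intros s hs; assert (h := inside s hs); unfold Omega; lra.
  + intros s hs; destruct (eqs s hs) as [p1 [p2 p3]]; [assert (h := inside s hs); lra|].
    split; [|split]; now apply is_derive_is_derive_in.
  + unfold X, V1, V2; rewrite !u0; auto.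
(* A competing solution obeys the same a priori estimate, hence solves the confined system too. *)
- intros X' V1' V2' hchar.
  assert (hT' : 0 <= T) by lra.
  assert (htI : closed_interval 0 T t) by (unfold closed_interval; lra).
  assert (hsol := characteristic_solves_on T E1 E2 B Bext t x (v1, v2) X' V1' V2' hT' hchar).
  destruct hchar as [_ [_ [_ [eX eV]]]].
  assert (e1 : V1' t = v1) by congruence; assert (e2 : V2' t = v2) by congruence.
  set (X'' := fun s => X' (clamp 0 T s)) in *.
  set (V1'' := fun s => V1' (clamp 0 T s)) in *.
  set (V2'' := fun s => V2' (clamp 0 T s)) in *.
  assert (tX : X'' t = x) by (unfold X''; now rewrite clamp_id).
  assert (tV1 : V1'' t = v1) by (unfold V1''; now rewrite clamp_id).
  assert (tV2 : V2'' t = v2) by (unfold V2''; now rewrite clamp_id).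
  assert (hin : forall s, 0 <= s <= T -> d <= X'' s <= 1 - d).
  { intros s hs.
    assert (h : rho <= X'' s <= 1 - rho)
      by (apply (trap 0 T X'' V1'' V2''); auto; lra).
    unfold d; lra. }
  assert (hu : forall i s, 0 <= s <= T -> phase_path X'' V1'' V2'' i s = u i s).
  { apply (bounded_lipschitz_uniqueness L M F 0 T t (phase_path X'' V1'' V2'') u); auto.
    - intros i s hs; destruct (proj1 hsol s hs) as [_ [c1 [c2 c3]]]; now destruct i.
    - intros i s hs; destruct (proj2 hsol s hs) as [d1 [d2 d3]].
      destruct (confined_field_spec T d E1 E2 B Bext X'' V1'' V2'' s) as [q1 [q2 q3]].
      + unfold closed_interval; lra.
      + apply hin; lra.
      + unfold F; destruct i; [rewrite q1|rewrite q2|rewrite q3]; easy.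
    - intros i; rewrite u0; destruct i; easy. }
  intros s hs.
  assert (g1 := hu Position s hs); assert (g2 := hu Velocity1 s hs).
  assert (g3 := hu Velocity2 s hs); simpl in g1, g2, g3.
  unfold X'', V1'', V2'' in g1, g2, g3; rewrite clamp_id in g1, g2, g3 by easy; auto.
Qed.
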